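(* Let $m,n\ge 1$ and let $u=(u_i)_{i=1}^m:\mathbb{R}^n\to\mathbb{R}^m$ be a stable classical solution of $$-\operatorname{div}\big(\Phi'(|\nabla u_i|^2)\nabla u_i\big)=H_i(u)\quad\text{in }\mathbb{R}^n,\qquad i=1,\dots,m.$$ Then for any $\eta=(\eta_k)_{k=1}^m$ with $\eta_k\in C_c^1(\mathbb{R}^n)$, $$\begin{aligned} &\sum_{i\ne j}\int_{\mathbb{R}^n}\left[\sqrt{\partial_jH_i(u)\,\partial_iH_j(u)}\,|\nabla u_i||\nabla u_j|\eta_i\eta_j-\partial_jH_i(u)\,\nabla u_i\cdot\nabla u_j\,\eta_i^2\right]\\ &+\sum_{i=1}^m\int_{\{|\nabla u_i|\ne 0\}\cap\mathbb{R}^n}\Phi'(|\nabla u_i|^2)|\nabla u_i|^2\mathcal{K}_i^2\eta_i^2\\ &+\sum_{i=1}^m\int_{\{|\nabla u_i|\ne 0\}\cap\mathbb{R}^n}\left[2\Phi''(|\nabla u_i|^2)|\nabla u_i|^2+\Phi'(|\nabla u_i|^2)\right]\big|\nabla_{T_i}|\nabla u_i|\big|^2\eta_i^2\\ &\le\sum_{i=1}^m\int_{\mathbb{R}^n}2|\nabla u_i|^2\Phi''(|\nabla u_i|^2)|\nabla u_i\cdot\nabla\eta_i|^2+\Phi'(|\nabla u_i|^2)|\nabla u_i|^2|\nabla\eta_i|^2, \end{aligned}$$ where $\nabla_{T_i}$ stands for the tangential gradient along a given level set of $u_i$ and $\mathcal{K}_i^2$ for the sum of squares of the principal curvatures of such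 a level set.
   Context: Standing assumptions: $\Phi\in C^2(\mathbb{R}^+)$, $\Phi(0)=0$, and $\Phi(s)$, $\Phi'(s)$ and $\Phi'(s)+2s\Phi''(s)$ are positive for $s>0$. Each $H_i\in C^1(\mathbb{R}^m)$ is real valued; with $\partial_jH_i(u)=\partial H_i(u)/\partial u_j$ one assumes $\partial_iH_j(u)\,\partial_jH_i(u)>0$ for $1\le i\le j\le m$. For $\eta\in\mathbb{R}^n$, $\mathcal{A}(\eta)=(a_{k,l}(\eta))_{k,l=1}^n$ with $a_{k,l}(\eta)=2\Phi''(|\eta|^2)\eta_k\eta_l+\Phi'(|\eta|^2)\delta_{kl}$. A solution $u$ is called stable if there exist functions $\phi=(\phi_k)_{k=1}^m$ such that each $\phi_i$ does not change sign, $\partial_jH_i(u)\phi_j\phi_i>0$ for all $i,j=1,\dots,m$, and $-\operatorname{div}(\mathcal{A}(\nabla u_i)\nabla\phi_i)=\sum_{j=1}^m\partial_jH_i(u)\phi_j$ in $\mathbb{R}^n$ for every $i$. *)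

(* Defs.v *)
From HB Require Import structures.
From mathcomp Require Import all_boot all_order all_algebra.
From mathcomp Require Import all_classical all_reals all_analysis.

Set Implicit Arguments.
Unset Strict Implicit.
Unset Printing Implicit Defensive.

Import Order.TTheory GRing.Theory Num.Theory.
Import numFieldNormedType.Exports.

Local Open Scope classical_set_scope.
Local Open Scope ring_scope.

Section LebesgueMeasureTuple.
Context {R : realType}.

Definition tuple_cons n (p : measurableTypeR R * n.-tuple (measurableTypeR R)) :
  n.+1.-tuple (measurableTypeR R) := [tuple of p.1 :: p.2].

Lemma measurable_tuple_cons n : measurable_fun [set: _] (@tuple_cons n).
Proof. exact: measurable_cons. Qed.

Lemma measurable_tuple_uncons n :
  measurable_fun [set: n.+1.-tuple (measurableTypeR R)]
    (fun t => (thead t, [tuple of behead t])).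
Proof.
by apply/measurable_fun_pair; [exact: measurable_tnth|exact: measurable_behead].
Qed.

Section Step.
Variables (n : nat)
  (mu : {sigma_finite_measure set (n.-tuple (measurableTypeR R)) -> \bar R}).

Let leb1 : {sigma_finite_measure set (measurableTypeR R) -> \bar R} :=
  @lebesgue_measure R.

Definition lebesgue_step : set (n.+1.-tuple (measurableTypeR R)) -> \bar R :=
  pushforward (product_measure1 leb1 mu) (@tuple_cons n).

Let prodmu : {measure
    set (measurableTypeR R * n.-tuple (measurableTypeR R))%type -> \bar R} :=
  product_measure1 leb1 mu.

Let step0 : lebesgue_step set0 = 0%E.
Proof. by rewrite /lebesgue_step /pushforward preimage_set0 measure0. Qed.

Let step_ge0 A : (0 <= lebesgue_step A)%E.
Proof. exact: (measure_ge0 prodmu). Qed.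

Let step_sigma_additive : semi_sigma_additive lebesgue_step.
Proof.
move=> F mF tF mUF; rewrite /lebesgue_step /pushforward preimage_bigcup.
apply: (@measure_semi_sigma_additive _ _ _ prodmu).
- by move=> k; rewrite -[X in measurable X]setTI; exact: measurable_tuple_cons.
- apply/trivIsetP => /= i j _ _ ij; rewrite -preimage_setI.
  by move/trivIsetP : tF => /(_ _ _ _ _ ij) ->//; rewrite preimage_set0.
- rewrite -preimage_bigcup -[X in measurable X]setTI.
  exact: measurable_tuple_cons.
Qed.

HB.instance Definition _ := isMeasure.Build _ _ _ lebesgue_step
  step0 step_ge0 step_sigma_additive.

Let step_sigma_finite : sigma_finite setT lebesgue_step.
Proof.
have /sigma_finiteP[F [TF ndF Foo]] := sigma_finiteT leb1.
have /sigma_finiteP[G [TG ndG Goo]] := sigma_finiteT mu.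
exists (fun k => (fun t => (thead t, [tuple of behead t])) @^-1` (F k `*` G k)).
  apply/seteqP; split => // t _.
  have [i _ Fi] : (\bigcup_k F k) (thead t) by rewrite -TF.
  have [j _ Gj] : (\bigcup_k G k) [tuple of behead t] by rewrite -TG.
  exists (maxn i j) => //; split => /=.
    by move: Fi; exact/subsetPset/ndF/leq_maxl.
  by move: Gj; exact/subsetPset/ndG/leq_maxr.
move=> k; have [mF Fk] := Foo k; have [mG Gk] := Goo k; split.
  rewrite -[X in measurable X]setTI; apply: measurable_tuple_uncons => //.
  exact: measurableX.
rewrite /lebesgue_step /pushforward (_ : _ @^-1` _ = F k `*` G k).
  by rewrite product_measure1E// lte_mul_pinfty// ge0_fin_numE.
apply/seteqP; split => -[x t]; rewrite /preimage/= theadE;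
  by rewrite (_ : [tuple of behead (tuple_cons (x, t))] = t) //; exact/val_inj.
Qed.

HB.instance Definition _ := Measure_isSigmaFinite.Build _ _ _ lebesgue_step
  step_sigma_finite.
End Step.

Fixpoint lebesgue_tuple (n : nat) :
    {sigma_finite_measure set (n.-tuple (measurableTypeR R)) -> \bar R} :=
  match n with
  | 0 => [the {sigma_finite_measure set _ -> \bar R} of \d_ [tuple]]
  | n'.+1 => [the {sigma_finite_measure set _ -> \bar R} of
      lebesgue_step (lebesgue_tuple n')]
  end.

Lemma lebesgue_tuple_box n (A : 'I_n -> set (measurableTypeR R)) :
  (forall i, measurable (A i)) ->
  lebesgue_tuple n [set t | forall i, A i (tnth t i)] =
  (\prod_(i < n) @lebesgue_measure R (A i))%E.
Proof.
elim: n A => [|n IH] A mA.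
  by rewrite big_ord0 /= diracE mem_set // => -[].
rewrite big_ord_recl -IH; last by move=> i; exact: mA.
have mB : measurable
    [set t : n.-tuple (measurableTypeR R) | forall i, A (lift ord0 i) (tnth t i)].
  rewrite (_ : mkset _ =
    \bigcap_(i in [set: 'I_n]) ((@tnth n _)^~ i @^-1` A (lift ord0 i))).
    apply: fin_bigcap_measurable => // i _.
    by rewrite -[X in measurable X]setTI; exact: measurable_tnth.
  by apply/seteqP; split => t /= H i => [_|]; exact: H.
rewrite -product_measure1E//=; congr (product_measure1 _ _ _).
apply/seteqP; split => -[x t] /=.
  by move=> H; split; [exact: (H ord0)|move=> i; have := H (lift ord0 i); rewrite tnthS].
move=> [H0 H] i; have [j ->|->//] := unliftP ord0 i.
by rewrite tnthS; exact: H.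
Qed.
End LebesgueMeasureTuple.

(* Integrals over R^n: 'rV[R]_n carries no measurable structure in the library,
   so the integration variable is a tuple, transported to a row vector. *)
Section IntegralRn.
Context {R : realType} {n : nat}.

Definition row_of_tuple (t : n.-tuple R) : 'rV[R]_n := \row_k tnth t k.

Definition integral_Rn (D : set 'rV[R]_n) (f : 'rV[R]_n -> R) : R :=
  Rintegral (lebesgue_tuple n : set (n.-tuple (measurableTypeR R)) -> \bar R)
    (row_of_tuple @^-1` D) (f \o row_of_tuple).
End IntegralRn.

Section Calculus.
Context {R : realType} {n : nat}.
Implicit Types (f : 'rV[R]_n -> R) (F : 'rV[R]_n -> 'rV[R]_n) (x y : 'rV[R]_n).

Definition dot x y : R := \sum_k x 0 k * y 0 k.

(* The library norm on 'rV[R]_n is the sup norm. *)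
Definition enorm x : R := Num.sqrt (dot x x).

Definition partial (k : 'I_n) f x : R := 'D_(delta_mx 0 k) f x.

Definition grad f x : 'rV[R]_n := \row_k partial k f x.

Definition div F x : R := \sum_k partial k (fun y => F y 0 k) x.

Definition C1 f : Prop :=
  (forall x, differentiable f x) /\ (forall k, continuous (partial k f)).

Definition C2 f : Prop := C1 f /\ (forall k, C1 (partial k f)).

Definition C1c f : Prop := C1 f /\ compact (closure [set x | f x != 0]).

(* [- div F = g] in the sense of distributions. *)
Definition weak_neg_div F (g : 'rV[R]_n -> R) : Prop :=
  forall psi, C1c psi ->
    integral_Rn setT (fun x => dot (F x) (grad psi x)) =
    integral_Rn setT (fun x => g x * psi x).
End Calculus.

(* Functions of class C^2 on [0, +oo[; the derivative at 0 is one-sided. *)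
Section HalfLine.
Context {R : realType}.
Implicit Types (f : R -> R) (s : R).

Definition quotient_at f s : R -> R := fun t => (f t - f s) / (t - s).

Definition derivable_nneg f s : Prop :=
  cvg (quotient_at f s @ within [set t | 0 <= t] s^').

Definition derive_nneg f s : R :=
  lim (quotient_at f s @ within [set t | 0 <= t] s^').

Definition C2_nneg f : Prop :=
  [/\ forall s, 0 <= s -> derivable_nneg f s,
      forall s, 0 <= s -> derivable_nneg (derive_nneg f) s &
      {within [set t | 0 <= t], continuous (derive_nneg (derive_nneg f))}].
End HalfLine.

Section LevelSets.
Context {R : realType} {n : nat}.
Implicit Types (u f : 'rV[R]_n -> R) (x : 'rV[R]_n).

(* Unit normal, at x, of the level set of u through x. *)
Definition normal u x : 'rV[R]_n := (enorm (grad u x))^-1 *: grad u x.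

Definition tangential_grad u f x : 'rV[R]_n :=
  grad f x - dot (grad f x) (normal u x) *: normal u x.

(* The principal curvatures at x of the level set of u through x, listed with
   multiplicity: the eigenvalues of the Weingarten map v |-> - D_v (normal u)
   of the tangent space, along an orthonormal basis e of principal directions. *)
Definition principal_curvatures u x (kappa : 'I_n.-1 -> R) : Prop :=
  exists e : 'I_n.-1 -> 'rV[R]_n,
    [/\ forall a b, dot (e a) (e b) = (a == b)%:R,
        forall a, dot (e a) (normal u x) = 0 &
        forall a, - 'D_(e a) (normal u) x = kappa a *: e a].

(* The value does not depend on the choice of kappa, which is unique up to the
   order of its entries. *)
Definition curvature_sq u x : R :=
  xget 0 [set s | exists kappa, principal_curvatures u x kappa /\
                                s = \sum_a kappa a ^+ 2].
End LevelSets.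

Section QuasilinearSystem.
Context {R : realType} {m n : nat}.
Variables (Phi : R -> R) (H : 'I_m -> 'rV[R]_m -> R).
Implicit Type u : 'rV[R]_n -> 'rV[R]_m.

Definition component u (i : 'I_m) : 'rV[R]_n -> R := fun x => u x 0 i.

Definition Amx (eta : 'rV[R]_n) : 'M[R]_n :=
  \matrix_(k, l)
    (2 * derive_nneg (derive_nneg Phi) (enorm eta ^+ 2) * eta 0 k * eta 0 l
     + derive_nneg Phi (enorm eta ^+ 2) * (k == l)%:R).

Definition classical_solution u : Prop :=
  (forall i, C2 (component u i)) /\
  (forall i x,
     - div (fun y => derive_nneg Phi (enorm (grad (component u i) y) ^+ 2)
                       *: grad (component u i) y) x = H i (u x)).

Definition stable u : Prop :=
  exists phi : 'I_m -> 'rV[R]_n -> R,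
    [/\ forall i, C1 (phi i),
        forall i, (forall x, 0 <= phi i x) \/ (forall x, phi i x <= 0),
        forall i j x, 0 < partial j (H i) (u x) * phi j x * phi i x &
        forall i, weak_neg_div
          (fun x => (Amx (grad (component u i) x) *m (grad (phi i) x)^T)^T)
          (fun x => \sum_j partial j (H i) (u x) * phi j x)].
End QuasilinearSystem.

(* Main.v *)
From HB Require Import structures.
Require Import Defs.
From mathcomp Require Import all_boot all_order all_algebra.
From mathcomp Require Import all_classical all_reals all_analysis.
From mathcomp Require Import measurable_realfun.
From mathcomp Require Import ring lra.

Set Implicit Arguments.
Unset Strict Implicit.
Unset Printing Implicit Defensive.

Import Order.TTheory GRing.Theory Num.Theory.
Import numFieldNormedType.Exports.

Local Open Scope classical_set_scope.
Local Open Scope ring_scope.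

(** The inequality comes from comparing two weak identities, tested against
well chosen functions, and from a pointwise identity of geometric nature.

Write g_i = |grad u_i|^2, and A for the bilinear form of the matrix A(grad u_i).  Since
the entry (i, i) of the sign condition forces phi_i to vanish nowhere, g_i eta_i^2 / phi_i
is a test function of class C^1 for the equation of phi_i: it involves g_i, not
|grad u_i|, which is only Lipschitz at critical points.  Writing
a_ij = d_j H_i(u) phi_j / phi_i > 0, the arithmetic-geometric mean inequality
(coupling_le) bounds the sum of the zero order terms a_ij g_i eta_i^2 with i <> j
from below by that of sqrt (d_j H_i d_i H_j) |grad u_i| |grad u_j| eta_i eta_j.

Differentiating the equation of u_i in the direction k, testing it against
d_k u_i eta_i^2 and summing over k gives an identity (linearized_tested) whose zero
order terms are the d_j H_i(u) (grad u_i, grad u_j) eta_i^2; the diagonal ones cancel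
those of the first identity.  As u_i is only of class C^2, the equation is
differentiated weakly, by difference quotients (differentiated_weak); that the
integral of a derivative vanishes follows in the same way from translation
invariance of the Lebesgue measure (Int_partial).

What remains concerns one component u at a time, and is pointwise.  Completing a
square in the terms that contain phi (stability_square), one is left with
sum_k A(grad d_k u, grad d_k u) - A(grad g, grad g) / (4 g), which at regular points is
  (2 Phi'' g + Phi') |grad_T |grad u||^2
    + Phi' (|D|^2 - |grad |grad u||^2 - |grad_T |grad u||^2)
with D the Hessian of u.  The last bracket is the squared norm of the
restriction of D to the tangent space of the level set, that is g times the sum of
the squared principal curvatures.  Only the inequality between the two is used
(curvature_sq_bounds), and it follows from the Bessel inequality for the principal
directions; when there is no such family the curvature term is 0, and the bound says
that a squared norm is nonnegative.  Nothing is known about the measurability of the curvature term;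
integrals of nonnegative functions being superadditive without any measurability
(integral_Rn_superadd), the pointwise bound by a continuous function with compact
support is enough to conclude (geometric_le). *)

(** * Translation invariance of the Lebesgue measure on R^n *)

Section TranslationInvariance.
Context {R : realType}.
Local Notation mR := (measurableTypeR R).

Lemma measurable_addl (h : R) : measurable_fun [set: mR] (fun x : mR => x + h : mR).
Proof. exact: (measurable_funD (@measurable_id _ mR setT) (measurable_cst h)). Qed.

Lemma lebesgue_measure_translate (h : R) (A : set mR) : measurable A ->
  pushforward (@lebesgue_measure R) (fun x : mR => x + h : mR) A =
  lebesgue_measure A.
Proof.
have mh := measurable_addl h.
pose phi : {mfun mR >-> mR} := HB.pack (fun x : mR => x + h : mR) (isMeasurableFun.Build _ _ _ _ _ mh).
move=> mA; apply/esym/(@lebesgue_measure_unique R (pushforward (@lebesgue_measure R) phi)) => //= _ [[a b]] _ <-.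
rewrite /pushforward (_ : _ @^-1` _ = `]a - h, b - h]%classic); last first.
  by apply/seteqP; split => x /=; rewrite !in_itv/= ltrBlDr lerBrDr.
by rewrite !lebesgue_measure_itv/= !lte_fin ltrD2r -!EFinB opprB addrA subrK.
Qed.

Lemma ge0_integral_translate1 (h : R) (f : mR -> \bar R) :
  measurable_fun setT f -> (forall x, 0 <= f x)%E ->
  (\int[lebesgue_measure]_x f (x + h)%R = \int[lebesgue_measure]_x f x)%E.
Proof.
move=> mf f0.
have mh := measurable_addl h.
pose phi : {mfun mR >-> mR} := HB.pack (fun x : mR => x + h : mR) (isMeasurableFun.Build _ _ _ _ _ mh).
have := @ge0_integral_pushforward _ _ mR mR R phi mh (@lebesgue_measure R) setT f measurableT mf (fun y _ => f0 y).
rewrite preimage_setT => <-; apply: eq_measure_integral => A mA _.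
exact: lebesgue_measure_translate.
Qed.

(** Tonelli for the recursive definition of the measure, which peels off the first
coordinate; it reduces translations of R^n to those of the line. *)
Lemma ge0_integral_lebesgue_tupleS n (f : n.+1.-tuple mR -> \bar R) :
  measurable_fun setT f -> (forall x, 0 <= f x)%E ->
  (\int[lebesgue_tuple n.+1]_t f t =
   \int[lebesgue_measure]_x \int[lebesgue_tuple n]_t f (tuple_cons (x, t)))%E.
Proof.
move=> mf f0.
have mc := @measurable_tuple_cons R n.
have mfc : measurable_fun setT (f \o @tuple_cons R n) by exact: measurableT_comp.
rewrite -(fubini_tonelli1 (m1 := @lebesgue_measure R) (m2 := lebesgue_tuple n) _ mfc); last first.
  by move=> t; exact: f0.
have := @ge0_integral_pushforward _ _ _ _ R _ mc (product_measure1 (@lebesgue_measure R) (lebesgue_tuple n)) setT f measurableT mf (fun y _ => f0 y).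
by rewrite preimage_setT.
Qed.

Definition tuple_translate n (k : nat) (h : R) (t : n.-tuple mR) : n.-tuple mR :=
  [tuple tnth t i + (if i == k :> nat then h else 0) | i < n].

Lemma measurable_tuple_translate n k h :
  measurable_fun setT (@tuple_translate n k h).
Proof.
apply/measurable_fun_tnthP => i; rewrite (_ : _ \o _ =
  (fun t => tnth t i + (if i == k :> nat then h else 0))); last first.
  by apply/funext => t; rewrite /= tnth_mktuple.
by apply: measurable_funD => //; exact: measurable_tnth.
Qed.

Lemma ge0_integral_tuple_translate n k h (f : n.-tuple mR -> \bar R) :
  measurable_fun setT f -> (forall x, 0 <= f x)%E ->
  (\int[lebesgue_tuple n]_t f (tuple_translate k h t) =
   \int[lebesgue_tuple n]_t f t)%E.
Proof.
elim: n k f => [|n IH] k f mf f0.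
  apply: eq_integral => t _. rewrite (tuple0 (tuple_translate k h t)). by rewrite (tuple0 t).
have mc := @measurable_tuple_cons R n.
have mft : measurable_fun setT (f \o tuple_translate k h).
  by apply: measurableT_comp => //; exact: measurable_tuple_translate.
rewrite !ge0_integral_lebesgue_tupleS//.
have mfc : measurable_fun setT (f \o @tuple_cons R n) by exact: measurableT_comp.
case: k mft => [|k] mft.
  transitivity (\int[lebesgue_measure]_x
      (fun y => \int[lebesgue_tuple n]_t f (tuple_cons (y, t))) (x + h)%R)%E.
    apply: eq_integral => x _; apply: eq_integral => t _; congr f.
    apply: eq_from_tnth => i; rewrite tnth_mktuple.
    case: (unliftP ord0 i) => [j ->|->]; first by rewrite !tnthS addr0.
    by rewrite !(tnth_nth 0)/=.
  apply: (@ge0_integral_translate1 h (fun y => \int[lebesgue_tuple n]_t f (tuple_cons (y, t)))%E).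
    apply: (measurable_fun_fubini_tonelli_F (m2 := lebesgue_tuple n) _ mfc).
    by move=> t; exact: f0.
  by move=> x; apply: integral_ge0.
apply: eq_integral => x _.
rewrite -(IH k (fun t => f (tuple_cons (x, t)))) //; last first.
  by apply: (measurableT_comp mfc); exact: pair1_measurable.
apply: eq_integral => t _; congr f.
apply: eq_from_tnth => i; rewrite tnth_mktuple.
case: (unliftP ord0 i) => [j ->|->]; first by rewrite !tnthS tnth_mktuple.
by rewrite !(tnth_nth 0)/= addr0.
Qed.

End TranslationInvariance.

(** * Integrability of continuous functions with bounded support *)

Section RowVectors.
Context {R : realType} {n : nat}.
Local Notation rV := 'rV[R]_n.
Local Notation mR := (measurableTypeR R).

Lemma coord_le_norm (x : rV) i : `|x 0 i| <= `|x|.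
Proof.
rewrite [leRHS]/Num.Def.normr/= mx_normrE.
exact: (le_trans _ (@le_bigmax _ _ _ _ _ (ord0, i))).
Qed.

Lemma norm_le_coord (x : rV) r : 0 <= r -> (forall i, `|x 0 i| <= r) -> `|x| <= r.
Proof.
move=> r0 xr; rewrite [leLHS]/Num.Def.normr/= mx_normrE bigmax_le// => -[i j] _ /=.
by rewrite (ord1 i).
Qed.

Lemma bounded_on_ball (f : rV -> R) r : continuous f ->
  exists2 M, 0 <= M & forall x, `|x| <= r -> `|f x| <= M.
Proof.
move=> cf; pose A := [set x : rV | `|x| <= r].
have cA : compact A.
  apply: bounded_closed_compact.
    by exists r; split; [exact: num_real|move=> M rM x /= /le_trans; apply; exact: ltW].
  rewrite (_ : A = (fun x : rV => `|x|) @^-1` [set y | y <= r]) //.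
  by apply: closed_comp => [x _|]; [exact: norm_continuous|exact: closed_le].
have [M [_ HM]] : bounded_set (f @` A).
  by apply/compact_bounded/continuous_compact => //; exact: continuous_subspaceT.
exists (`|M| + 1); first by rewrite addr_ge0.
move=> x xr; apply: HM; first by rewrite (le_lt_trans (ler_norm _))// ltrDl.
by exists x.
Qed.

(** The sigma-algebra on tuples is generated by the coordinates, whereas the open
sets of row vectors are those of the sup norm: an open set is the countable union
of the cubes with rational centre and radius 1 / (k + 1) that it contains. *)
Lemma measurable_row_of_tuple_open (U : set rV) : open U ->
  measurable (row_of_tuple @^-1` U : set (n.-tuple mR)).
Proof.
move=> oU.
pose box (q : {ffun 'I_n -> rat} * nat) : set (n.-tuple mR) :=
  [set t | forall i, (t \in [set t | `|tnth t i - ratr (q.1 i)| < q.2.+1%:R^-1])].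
pose F q : set (n.-tuple mR) :=
  if `[< box q `<=` row_of_tuple @^-1` U >] then box q else set0.
have mF q : measurable (F q).
  rewrite /F; case: ifP => // _.
  rewrite (_ : box q = \bigcap_(i in [set: 'I_n])
     (fun t => tnth t i) @^-1` (`]ratr (q.1 i) - q.2.+1%:R^-1, ratr (q.1 i) + q.2.+1%:R^-1[%classic)).
    apply: fin_bigcap_measurable => // i _.
    by rewrite -[X in measurable X]setTI; exact: measurable_tnth.
  apply/seteqP; split => t /= Ht i.
    by move=> _ /=; have := Ht i; rewrite inE/= in_itv/= ltr_distl.
  by rewrite inE/=; have := Ht i I; rewrite /= in_itv/= ltr_distl.
rewrite (_ : _ @^-1` _ = \bigcup_q F q).
  by apply: countable_bigcupT_measurable => //; exact: countableP.
apply/seteqP; split=> [t /= Ut|t [q _]]; last by rewrite /F; case: asboolP => // H /H.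
have [e /= e0 He] : exists2 e : R, 0 < e & ball (row_of_tuple t) e `<=` U.
  by have /nbhs_ballP[e e0 He] := open_nbhs_nbhs (conj oU Ut); exists e.
have [k _ Hk] := near_infty_natSinv_lt (PosNum (divr_gt0 e0 (ltr0n R 2))).
have {}Hk := Hk _ (leqnn k).
have k0 : 0 < k.+1%:R^-1 :> R by rewrite invr_gt0.
have Hq i : exists q : rat, `|tnth t i - ratr q| < k.+1%:R^-1.
  have : tnth t i - k.+1%:R^-1 < tnth t i + k.+1%:R^-1 by rewrite ltrD2l gtrN.
  move=> /rat_in_itvoo[q]; rewrite in_itv/= => Hq; exists q.
  by rewrite distrC ltr_distl.
have [q Hq'] := choice Hq.
pose qk : {ffun 'I_n -> rat} * nat := ([ffun i => q i], k).
exists qk => //; rewrite /F; case: asboolP => [_ i|H].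
  by rewrite inE/= ffunE.
exfalso; apply: H => s /= Hs; apply: He; split => // i j.
rewrite (ord1 i) /ball/= !mxE.
have := Hs j; rewrite inE/= ffunE => Hsj.
rewrite -(subrKA (ratr (q j))) (le_lt_trans (ler_normD _ _))//.
rewrite (splitr e); apply: ltrD; first exact: lt_trans (Hq' j) Hk.
by rewrite distrC; exact: lt_trans Hsj Hk.
Qed.

Lemma measurable_continuous_row (f : rV -> R) : continuous f ->
  measurable_fun [set: n.-tuple mR] (f \o row_of_tuple).
Proof.
move=> cf mD; apply: (measurability _ (RGenOInfty.measurableE R)) => //=.
move=> _ [_ [a ->] <-]; rewrite setTI.
rewrite (_ : _ @^-1` _ = row_of_tuple @^-1` (f @^-1` `]a, +oo[)) //.
apply: measurable_row_of_tuple_open; apply: open_comp => [x _|]; first exact: cf.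
exact: interval_open.
Qed.

(** Continuous functions with bounded, hence relatively compact, support. *)
Definition Cc (f : rV -> R) : Prop :=
  continuous f /\ exists r, forall x, r < `|x| -> f x = 0.

Definition cube (r : R) : set (n.-tuple mR) :=
  [set t | forall i, `[- r, r]%classic (tnth t i)].

Lemma measurable_cube r : measurable (cube r).
Proof.
rewrite (_ : cube r = \bigcap_(i in [set: 'I_n])
   (fun t => tnth t i) @^-1` (`[- r, r]%classic)).
  apply: fin_bigcap_measurable => // i _.
  by rewrite -[X in measurable X]setTI; exact: measurable_tnth.
by apply/seteqP; split => t /= Ht i => [_|]; exact: Ht.
Qed.

Lemma lebesgue_cube_fin r : (lebesgue_tuple n (cube r) < +oo)%E.
Proof.
rewrite (@lebesgue_tuple_box _ n (fun=> `[- r, r]%classic)) => [|_]; last exact: measurable_itv.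
rewrite ltey_eq (_ : (_ \is a fin_num) = true)//.
elim/big_ind : _ => // [x y|i _]; first exact: fin_numM.
by rewrite lebesgue_measure_itv/=; case: ifP.
Qed.

Lemma notin_cube r (t : n.-tuple mR) : 0 <= r -> ~ cube r t -> r < `|row_of_tuple t|.
Proof.
move=> r0; apply: contra_notT; rewrite -leNgt => tr i /=.
have := le_trans (coord_le_norm (row_of_tuple t) i) tr.
by rewrite mxE ler_norml in_itv.
Qed.

Lemma cube_norm r (t : n.-tuple mR) : 0 <= r -> cube r t -> `|row_of_tuple t| <= r.
Proof.
move=> r0 tr; apply: norm_le_coord => // i; rewrite mxE ler_norml.
by have := tr i; rewrite /= in_itv.
Qed.

(** The dominating function of every limit taken under the integral below. *)
Lemma integrable_cube_indic r M :
  (lebesgue_tuple n).-integrable setT (EFin \o ((cst M : n.-tuple mR -> R) \_ (cube r))).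
Proof.
rewrite -restrict_EFin; apply: (proj1 (integrable_mkcond _ (measurable_cube r))).
apply: measurable_bounded_integrable => //.
- exact: measurable_cube.
- exact: lebesgue_cube_fin.
- exists `|M|; split; first exact: num_real.
  by move=> x Mx t _; exact: ltW.
Qed.

Lemma Cc_dominated (f : rV -> R) r : continuous f -> (forall x, r < `|x| -> f x = 0) -> 0 <= r ->
  forall M, (forall x, `|x| <= r -> `|f x| <= M) ->
  forall t, `|f (row_of_tuple t)| <= ((cst M : n.-tuple mR -> R) \_ (cube r)) t.
Proof.
move=> cf fr r0 M fM t; rewrite patchE; case: ifPn => [|].
  by rewrite inE => tr; apply: fM; exact: cube_norm.
by rewrite notin_setE => tr; rewrite fr ?normr0//; exact: notin_cube.
Qed.

Lemma Cc_integrable (f : rV -> R) : Cc f ->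
  (lebesgue_tuple n).-integrable setT (EFin \o (f \o row_of_tuple)).
Proof.
move=> [cf [r fr]].
have fr' x : `|r| < `|x| -> f x = 0 by move=> /(le_lt_trans (ler_norm _)) /fr.
have [M M0 fM] := bounded_on_ball `|r| cf.
apply: le_integrable (integrable_cube_indic `|r| M) => //.
  by apply/measurable_EFinP; exact: measurable_continuous_row.
move=> t _; rewrite lee_fin/=.
by apply: le_trans (ler_norm _); apply: Cc_dominated.
Qed.
End RowVectors.

(** * Calculus of integrals of such functions *)

Section IntegralCc.
Context {R : realType} {n : nat}.
Local Notation rV := 'rV[R]_n.
Local Notation mR := (measurableTypeR R).
Local Notation I f := (integral_Rn setT f).
Implicit Types f g w : rV -> R.

Lemma ContD f g : continuous f -> continuous g -> continuous (fun x => f x + g x).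
Proof. by move=> cf cg x; exact: (cvgD (cf x) (cg x)). Qed.

Lemma ContB f g : continuous f -> continuous g -> continuous (fun x => f x - g x).
Proof. by move=> cf cg x; exact: (cvgB (cf x) (cg x)). Qed.

Lemma ContM f g : continuous f -> continuous g -> continuous (fun x => f x * g x).
Proof. by move=> cf cg x; exact: (cvgM (cf x) (cg x)). Qed.

Lemma ContX f k : continuous f -> continuous (fun x => f x ^+ k).
Proof.
move=> cf; elim: k => [|k IH]; first by rewrite (_ : (fun x => _) = cst 1)//; exact: cst_continuous.
rewrite (_ : (fun x => _) = (fun x => f x * f x ^+ k)); last by apply/funext => x; rewrite exprS.
exact: ContM.
Qed.

Lemma Cont_cst (c : R) : continuous (fun _ : rV => c).
Proof. exact: cst_continuous. Qed.

Lemma Cont_sum (T : Type) (s : seq T) (P : pred T) (F : T -> rV -> R) :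
  (forall i, P i -> continuous (F i)) -> continuous (fun x => \sum_(i <- s | P i) F i x).
Proof.
move=> cF; elim: s => [|i s IH].
  rewrite (_ : (fun x => _) = cst 0); first exact: cst_continuous.
  by apply/funext => x; rewrite big_nil.
have -> : (fun x => \sum_(j <- i :: s | P j) F j x) =
    (fun x => if P i then F i x + \sum_(j <- s | P j) F j x
              else \sum_(j <- s | P j) F j x).
  by apply/funext => x; rewrite big_cons.
by case Pi: (P i) => //; apply: ContD => //; exact: cF.
Qed.

Lemma CcD f g : Cc f -> Cc g -> Cc (fun x => f x + g x).
Proof.
move=> [cf [r fr]] [cg [s gs]]; split; first exact: ContD.
exists (Num.max r s) => x; rewrite gt_max => /andP[rx sx].
by rewrite fr// gs// addr0.
Qed.

Lemma CcMl f g : continuous f -> Cc g -> Cc (fun x => f x * g x).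
Proof.
move=> cf [cg [s gs]]; split; first exact: ContM.
by exists s => x sx; rewrite gs// mulr0.
Qed.

Lemma CcMr f g : Cc f -> continuous g -> Cc (fun x => f x * g x).
Proof.
move=> [cg [s gs]] cf; split; first exact: ContM.
by exists s => x sx; rewrite gs// mul0r.
Qed.

Lemma CcB f g : Cc f -> Cc g -> Cc (fun x => f x - g x).
Proof.
move=> cf cg; rewrite (_ : (fun x => _) = (fun x => f x + -1 * g x)); last first.
  by apply/funext => x; rewrite mulN1r.
by apply: CcD => //; apply: CcMl => //; exact: Cont_cst.
Qed.

Lemma Cc0 : Cc (fun _ : rV => 0 : R).
Proof. by split; [exact: Cont_cst|exists 0]. Qed.

Lemma Cc_sum (T : Type) (s : seq T) (P : pred T) (F : T -> rV -> R) :
  (forall i, P i -> Cc (F i)) -> Cc (fun x => \sum_(i <- s | P i) F i x).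
Proof.
move=> cF; elim: s => [|i s IH].
  by under eq_fun do rewrite big_nil; exact: Cc0.
under eq_fun do rewrite big_cons.
by case Pi: (P i) => //; apply: CcD => //; exact: cF.
Qed.

Lemma IntE f : I f =
  Rintegral (lebesgue_tuple n : set (n.-tuple mR) -> \bar R) setT (f \o row_of_tuple).
Proof. by rewrite /integral_Rn preimage_setT. Qed.

Lemma IntD f g : Cc f -> Cc g -> I (fun x => f x + g x) = I f + I g.
Proof.
by move=> /Cc_integrable cf /Cc_integrable cg; rewrite !IntE -RintegralD.
Qed.

Lemma IntB f g : Cc f -> Cc g -> I (fun x => f x - g x) = I f - I g.
Proof.
by move=> /Cc_integrable cf /Cc_integrable cg; rewrite !IntE -RintegralB.
Qed.

Lemma IntZ c f : Cc f -> I (fun x => c * f x) = c * I f.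
Proof. by move=> /Cc_integrable cf; rewrite !IntE -RintegralZl. Qed.

Lemma Int0 : I (fun _ : rV => 0) = 0.
Proof. by rewrite IntE Rintegral_cst// mul0r. Qed.

Lemma Int_sum (T : Type) (s : seq T) (P : pred T) (F : T -> rV -> R) :
  (forall i, P i -> Cc (F i)) ->
  I (fun x => \sum_(i <- s | P i) F i x) = \sum_(i <- s | P i) I (F i).
Proof.
move=> cF; elim: s => [|i s IH].
  by rewrite big_nil; under eq_fun do rewrite big_nil; exact: Int0.
rewrite big_cons; under eq_fun do rewrite big_cons.
case Pi: (P i) => //; rewrite IntD ?IH//; first exact: cF.
exact: Cc_sum.
Qed.

Lemma Int_le f g : Cc f -> Cc g -> (forall x, f x <= g x) -> I f <= I g.
Proof.
move=> /Cc_integrable cf /Cc_integrable cg fg; rewrite !IntE.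
by apply: le_Rintegral => // t _; exact: fg.
Qed.

Lemma row_of_tuple_translate (k : 'I_n) h (t : n.-tuple mR) :
  row_of_tuple (tuple_translate k h t) = row_of_tuple t + h *: delta_mx 0 k.
Proof.
apply/rowP => i; rewrite !mxE tnth_mktuple eqxx/=; congr (_ + _).
by rewrite -val_eqE; case: (_ == _); rewrite ?mulr1 ?mulr0.
Qed.

Lemma Int_translate (k : 'I_n) h f : continuous f ->
  I (fun x => f (x + h *: delta_mx 0 k)) = I f.
Proof.
move=> cf; rewrite !IntE /Rintegral; congr fine.
pose F := EFin \o (f \o row_of_tuple) : n.-tuple mR -> \bar R.
have mF : measurable_fun setT F by apply/measurable_EFinP; exact: measurable_continuous_row.
transitivity (\int[lebesgue_tuple n]_t F (tuple_translate k h t))%E.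
  by apply: eq_integral => t _; rewrite /F/= row_of_tuple_translate.
rewrite [RHS]integralE [LHS]integralE; congr (_ - _)%E.
  transitivity (\int[lebesgue_tuple n]_t F^\+ (tuple_translate k h t))%E; first by apply: eq_integral => t _; rewrite !funeposE.
  rewrite (@ge0_integral_tuple_translate R n k h F^\+%E (measurable_funepos mF) (fun t => funepos_ge0 F t)).
  by apply: eq_integral => t _; rewrite !funeposE.
transitivity (\int[lebesgue_tuple n]_t F^\- (tuple_translate k h t))%E; first by apply: eq_integral => t _; rewrite !funenegE.
rewrite (@ge0_integral_tuple_translate R n k h F^\-%E (measurable_funeneg mF) (fun t => funeneg_ge0 F t)).
by apply: eq_integral => t _; rewrite !funenegE.
Qed.

Lemma Int_dominated_cvg (w_ : nat -> rV -> R) w r M :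
  (forall j, continuous (w_ j)) ->
  (forall j x, r < `|x| -> w_ j x = 0) -> 0 <= r ->
  (forall j x, `|x| <= r -> `|w_ j x| <= M) ->
  (forall x, w_ j x @[j --> \oo] --> w x) ->
  I (w_ j) @[j --> \oo] --> I w.
Proof.
move=> cw wr r0 wM wl.
pose F j := EFin \o (w_ j \o row_of_tuple) : n.-tuple mR -> \bar R.
have mF j : measurable_fun setT (F j) by apply/measurable_EFinP; exact: measurable_continuous_row.
have Fl t : setT t -> (F ^~ t @ \oo --> (EFin \o (w \o row_of_tuple)) t)%E.
  by move=> _; apply: cvg_EFin; [exact: nearW|exact: wl].
have ig := @integrable_cube_indic R n r M.
have gf (t : n.-tuple mR) : setT t ->
    (EFin \o ((cst M : n.-tuple mR -> R) \_ (cube r))) t \is a fin_num by [].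
have Fg j (t : n.-tuple mR) : setT t ->
    (`|F j t| <= (EFin \o ((cst M : n.-tuple mR -> R) \_ (cube r))) t)%E.
  by move=> _; rewrite lee_fin; apply: Cc_dominated => //; [exact: wr|exact: wM].
under eq_fun do rewrite IntE.
have mw : measurable_fun setT (EFin \o (w \o row_of_tuple) : n.-tuple mR -> \bar R).
  exact: (emeasurable_fun_cvg _ _ mF Fl).
have [iw _ Hw] := dominated_convergence measurableT mF mw (aeW _ Fl) ig
  (aeW _ (fun t j => Fg j t)).
rewrite IntE; apply: fine_cvg; rewrite fineK; first exact: Hw.
exact: integrable_fin_num.
Qed.

Import HBNNSimple.

(** The integral of a nonnegative function is the supremum of the integrals of
the simple functions below it, so that it is superadditive even when the two
functions are not measurable. *)
Lemma ge0_integral_superadd (d : measure_display) (T : measurableType d)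
    (mu : {measure set T -> \bar R}) (f1 f2 W : T -> \bar R) :
  (forall t, 0 <= f1 t)%E -> (forall t, 0 <= f2 t)%E ->
  (forall t, f1 t + f2 t <= W t)%E -> (\int[mu]_t W t < +oo)%E ->
  (\int[mu]_t f1 t + \int[mu]_t f2 t <= \int[mu]_t W t)%E.
Proof.
move=> f10 f20 fW Wfin.
have W0 t : (0 <= W t)%E by apply: le_trans (fW t); exact: adde_ge0.
have Wge0 := @integral_ge0 _ _ _ mu setT W (fun x _ => W0 x).
have fin x : (0 <= x)%E -> (x <= \int[mu]_t W t)%E -> x \is a fin_num.
  by move=> x0 xW; rewrite ge0_fin_numE// (le_lt_trans xW).
have key (h1 h2 : {nnsfun T >-> R}) : (forall t, (h1 t)%:E <= f1 t)%E ->
    (forall t, (h2 t)%:E <= f2 t)%E -> (sintegral mu h1 + sintegral mu h2 <= \int[mu]_t W t)%E.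
  move=> h1f h2f; rewrite -sintegralD//.
  rewrite (ge0_integralTE mu W0); apply: ereal_sup_ubound.
  exists (add_nnsfun h1 h2) => //= t.
  by rewrite EFinD; apply: le_trans (fW t); exact: leeD.
have s0 (h : {nnsfun T >-> R}) : (0 <= sintegral mu h)%E by exact: sintegral_ge0.
have h0 (g : T -> \bar R) : (forall t, 0 <= g t)%E -> forall t, (((nnsfun0 : {nnsfun T >-> R}) t)%:E <= g t)%E by move=> g0 t; exact: g0.
have sW1 (h1 : {nnsfun T >-> R}) : (forall t, (h1 t)%:E <= f1 t)%E -> (sintegral mu h1 <= \int[mu]_t W t)%E.
  move=> h1f; apply: le_trans (key h1 _ h1f (h0 _ f20)); exact: leeDl.
have sW2 (h2 : {nnsfun T >-> R}) : (forall t, (h2 t)%:E <= f2 t)%E -> (sintegral mu h2 <= \int[mu]_t W t)%E.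
  move=> h2f; apply: le_trans (key _ h2 (h0 _ f10) h2f); exact: leeDr.
have e2 : (\int[mu]_t f2 t \is a fin_num)%E.
  apply: fin; first exact: integral_ge0.
  by rewrite (ge0_integralTE mu f20); apply: ge_ereal_sup => _ [h /= hf <-]; exact: sW2.
rewrite -leeBrDr//.
rewrite (ge0_integralTE mu f10); apply: ge_ereal_sup => _ [h1 /= h1f <-].
have sh1 : sintegral mu h1 \is a fin_num by apply: fin => //; exact: sW1.
rewrite leeBrDr// -leeBrDl//.
rewrite (ge0_integralTE mu f20); apply: ge_ereal_sup => _ [h2 /= h2f <-].
by rewrite leeBrDl//; exact: key.
Qed.

Lemma integral_Rn_superadd (D : set rV) (f1 f2 W : rV -> R) : Cc W ->
  (forall x, D x -> 0 <= f1 x) -> (forall x, D x -> 0 <= f2 x) ->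
  (forall x, D x -> f1 x + f2 x <= W x) -> (forall x, ~ D x -> 0 <= W x) ->
  integral_Rn D f1 + integral_Rn D f2 <= I W.
Proof.
move=> cW f10 f20 fW W0.
pose mu := @lebesgue_tuple R n.
pose P (f : rV -> R) := EFin \o ((f \o row_of_tuple) \_ (row_of_tuple @^-1` D)) : n.-tuple mR -> \bar R.
have PE f : integral_Rn D f = fine (\int[mu]_t P f t)%E.
  by rewrite /integral_Rn /Rintegral integral_mkcond restrict_EFin.
have P0 f : (forall x, D x -> 0 <= f x) -> forall t, (0 <= P f t)%E.
  move=> f0 t; rewrite lee_fin patchE; case: ifP => //=; rewrite inE; exact: f0.
have iW := Cc_integrable cW.
have Wfin := integrable_fin_num measurableT iW.
have H : (\int[mu]_t P f1 t + \int[mu]_t P f2 t <= \int[mu]_t (EFin \o (W \o row_of_tuple)) t)%E.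
  apply: ge0_integral_superadd; [exact: P0|exact: P0| |by rewrite ltey_eq Wfin].
  move=> t; rewrite lee_fin !patchE /=; case: ifPn.
    by rewrite inE; exact: fW.
  by rewrite notin_setE addr0; exact: W0.
have i1 := @integral_ge0 _ _ _ mu setT _ (fun t _ => P0 f1 f10 t).
have i2 := @integral_ge0 _ _ _ mu setT _ (fun t _ => P0 f2 f20 t).
have fin1 : (\int[mu]_t P f1 t \is a fin_num)%E.
  by rewrite ge0_fin_numE// (le_lt_trans (leeDl _ i2))// (le_lt_trans H)// ltey_eq Wfin.
have fin2 : (\int[mu]_t P f2 t \is a fin_num)%E.
  by rewrite ge0_fin_numE// (le_lt_trans (leeDr _ i1))// (le_lt_trans H)// ltey_eq Wfin.
by rewrite !PE IntE /Rintegral -lee_fin EFinD !fineK.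
Qed.
End IntegralCc.

(** * Rules for partial derivatives *)

Section Calculus.
Context {R : realType} {n : nat}.
Local Notation rV := 'rV[R]_n.
Implicit Types (f g : rV -> R) (x : rV) (k : 'I_n).
Local Notation e_ k := (delta_mx 0 k : rV).

Lemma C1_continuous f : C1 f -> continuous f.
Proof. by move=> [df _] x; exact: differentiable_continuous. Qed.

Lemma C1_diff f x : C1 f -> differentiable f x.
Proof. by move=> [df _]. Qed.

Lemma C1_partial_continuous k f : C1 f -> continuous (partial k f).
Proof. by move=> []. Qed.

Lemma partialD k f g x : differentiable f x -> differentiable g x ->
  partial k (fun y => f y + g y) x = partial k f x + partial k g x.
Proof. by move=> df dg; rewrite /partial deriveD//; exact: diff_derivable. Qed.

Lemma partialB k f g x : differentiable f x -> differentiable g x ->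
  partial k (fun y => f y - g y) x = partial k f x - partial k g x.
Proof. by move=> df dg; rewrite /partial deriveB//; exact: diff_derivable. Qed.

Lemma partialM k f g x : differentiable f x -> differentiable g x ->
  partial k (fun y => f y * g y) x = f x * partial k g x + g x * partial k f x.
Proof. by move=> df dg; rewrite /partial deriveM//; exact: diff_derivable. Qed.

Lemma partial_cst k (c : R) x : partial k (fun _ : rV => c) x = 0.
Proof. by rewrite /partial derive_cst. Qed.

Lemma partial_sum (T : Type) (s : seq T) (F : T -> rV -> R) x :
  (forall i, differentiable (F i) x) ->
  differentiable (fun y => \sum_(i <- s) F i y) x /\
  forall k, partial k (fun y => \sum_(i <- s) F i y) x = \sum_(i <- s) partial k (F i) x.
Proof.
move=> dF; elim: s => [|i s [IHd IHp]].
  have -> : (fun y => \sum_(j <- [::]) F j y) = cst 0.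
    by apply/funext => y; rewrite big_nil.
  by split=> [|k]; [exact: differentiable_cst|rewrite big_nil; exact: partial_cst].
have -> : (fun y => \sum_(j <- i :: s) F j y) = (fun y => F i y + \sum_(j <- s) F j y).
  by apply/funext => y; rewrite big_cons.
split=> [|k]; first exact: differentiableD.
by rewrite partialD// big_cons IHp.
Qed.

Lemma partialV k f x : f x != 0 -> differentiable f x ->
  partial k (fun y => (f y)^-1) x = - (f x ^- 2) * partial k f x.
Proof. by move=> f0 df; rewrite /partial deriveV//; exact: diff_derivable. Qed.

Lemma partial_comp (h : R -> R) dh f x : is_derive (f x) 1 h dh ->
  differentiable f x ->
  differentiable (h \o f) x /\ forall k, partial k (h \o f) x = dh * partial k f x.
Proof.
move=> hd df; have dhh : differentiable h (f x) by apply/derivable1_diffP.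
split=> [|k]; first exact: differentiable_comp.
rewrite /partial deriveE; last exact: differentiable_comp.
rewrite diff_comp// deriveE//= deriv1E; last exact/derivable1_diffP.
by rewrite derive1E (@derive_val _ _ _ _ _ _ _ hd) mulrC.
Qed.

Lemma partial_translate k f c x :
  partial k (fun y => f (y + c)) x = partial k f (x + c).
Proof.
rewrite /partial /derive.
have -> // : (fun y => f (y + c)) \o shift x = f \o shift (x + c).
by apply/funext => h /=; rewrite addrA.
Qed.

Lemma C1_cst (c : R) : C1 (fun _ : rV => c).
Proof.
split=> [x|k]; first exact: differentiable_cst.
rewrite (_ : partial k _ = cst 0); first exact: cst_continuous.
by apply/funext => x; rewrite partial_cst.
Qed.

Lemma C1B f g : C1 f -> C1 g -> C1 (fun x => f x - g x).
Proof.
move=> [df cf] [dg cg]; split=> [x|k]; first exact: differentiableB.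
rewrite (_ : partial k _ = fun x => partial k f x - partial k g x).
  exact: ContB.
by apply/funext => x; rewrite partialB.
Qed.

Lemma C1M f g : C1 f -> C1 g -> C1 (fun x => f x * g x).
Proof.
move=> [df cf] [dg cg]; split=> [x|k]; first exact: differentiableM.
rewrite (_ : partial k _ = fun x => f x * partial k g x + g x * partial k f x).
  by apply: ContD; apply: ContM => // x; exact: differentiable_continuous.
by apply/funext => x; rewrite partialM.
Qed.

Lemma C1_sum (T : Type) (s : seq T) (F : T -> rV -> R) :
  (forall i, C1 (F i)) -> C1 (fun x => \sum_(i <- s) F i x).
Proof.
move=> cF; split=> [x|k].
  by have [] := @partial_sum T s F x (fun i => C1_diff x (cF i)).
rewrite (_ : partial k _ = fun x => \sum_(i <- s) partial k (F i) x).
  by apply: Cont_sum => i _; exact: C1_partial_continuous.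
by apply/funext => x; have [_ ->] := @partial_sum T s F x (fun i => C1_diff x (cF i)).
Qed.

Lemma ContV f : continuous f -> (forall x, f x != 0) -> continuous (fun x => (f x)^-1).
Proof. by move=> cf f0 x; exact: (cvgV (f0 x) (cf x)). Qed.

Lemma C1V f : (forall x, f x != 0) -> C1 f -> C1 (fun x => (f x)^-1).
Proof.
move=> f0 cf; split=> [x|k].
  by apply: differentiableV => //; exact: C1_diff.
rewrite (_ : partial k _ = fun x => - 1 * (((f x)^-1) ^+ 2 * partial k f x)).
  apply: ContM; first exact: Cont_cst.
  apply: ContM; last exact: C1_partial_continuous.
  by apply: ContX; apply: ContV => //; exact: C1_continuous.
by apply/funext => x; rewrite partialV// ?exprVn ?mulN1r ?mulNr//; exact: C1_diff.
Qed.

Lemma C1_comp (h dh : R -> R) f : (forall s : R, is_derive s 1 h (dh s)) ->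
  continuous dh -> C1 f -> C1 (h \o f).
Proof.
move=> hd cdh cf; split=> [x|k].
  by have [] := @partial_comp h _ f x (hd _) (C1_diff x cf).
rewrite (_ : partial k _ = fun x => dh (f x) * partial k f x).
  apply: ContM; last exact: C1_partial_continuous.
  move=> x; apply: continuous_comp; last exact: cdh.
  exact: C1_continuous.
by apply/funext => x; have [_ ->] := @partial_comp h _ f x (hd _) (C1_diff x cf).
Qed.

Lemma C1_translate f c : C1 f -> C1 (fun x => f (x + c)).
Proof.
move=> [df cf]; split=> [x|k].
  exact: (@differentiable_comp _ _ _ _ (fun x => x + c) f).
rewrite (_ : partial k _ = partial k f \o (fun x => x + c)).
  move=> x; apply: continuous_comp; last exact: cf.
  exact: (cvgD cvg_id (cvg_cst c)).
by apply/funext => x; rewrite partial_translate.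
Qed.

(** The difference quotients of f along the line are literally those that define
the directional derivative of f. *)
Lemma derive_line f k x (s : R) : differentiable f (x + s *: e_ k) ->
  is_derive s 1 (fun t : R => f (x + t *: e_ k)) (partial k f (x + s *: e_ k)).
Proof.
move=> df.
have E : (fun h : R => h^-1 *: (((fun t : R => f (x + t *: e_ k)) \o shift s) (h *: 1) - f (x + s *: e_ k)))
    = (fun h : R => h^-1 *: ((f \o shift (x + s *: e_ k)) (h *: e_ k) - f (x + s *: e_ k))).
  apply/funext => h /=; rewrite [h *: 1]mulr1 scalerDl addrCA.
  by [].
have dfk : derivable f (x + s *: e_ k) (e_ k) by exact: diff_derivable.
rewrite /derivable in dfk.
by apply: DeriveDef; rewrite /derivable ?/partial ?/derive E.
Qed.

Lemma MVT_line f k x (h : R) : (forall y, differentiable f y) -> 0 < h ->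
  exists2 s, 0 < s < h & f (x + h *: e_ k) - f x = h * partial k f (x + s *: e_ k).
Proof.
move=> df h0.
have [||s] := @MVT R (fun t : R => f (x + t *: e_ k))
   (fun t => partial k f (x + t *: e_ k)) 0 h h0.
- by move=> s _; exact: derive_line.
- apply: continuous_subspaceT => s; apply: differentiable_continuous.
  by apply/derivable1_diffP; apply: ex_derive; exact: derive_line.
- by rewrite in_itv/= scale0r addr0 subr0 => sh ->; exists s => //; rewrite mulrC.
Qed.

Lemma norm_delta_le1 k : `|e_ k| <= 1.
Proof.
by apply: norm_le_coord => // i; rewrite !mxE eqxx/=; case: (_ == _); rewrite ?normr1 ?normr0.
Qed.

(** The second difference of f is symmetric in k and l, and two applications of the
mean value theorem turn it into a second derivative at a nearby point. *)
Lemma second_difference f k l x h : C2 f -> 0 < h ->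
  exists y, `|y - x| < 2 * h /\
  f (x + h *: e_ k + h *: e_ l) - f (x + h *: e_ k) - (f (x + h *: e_ l) - f x) =
  h ^+ 2 * partial l (partial k f) y.
Proof.
move=> [C1f C2f] h0.
pose F y := f (y + h *: e_ l) - f y.
have dF y : differentiable F y by apply: C1_diff; apply: C1B => //; exact: C1_translate.
have [s /andP[s0 sh] Es] := @MVT_line F k x h dF h0.
have [t /andP[t0 th] Et] := @MVT_line (partial k f) l (x + s *: e_ k) h
  (fun y => C1_diff y (C2f k)) h0.
exists (x + s *: e_ k + t *: e_ l); split.
  rewrite -(addrA x) [_ - x]addrC addKr (le_lt_trans (ler_normD _ _))// !normrZ.
  rewrite mulr_natl mulr2n; apply: ltrD.
    by rewrite (le_lt_trans _ sh)// gtr0_norm// (ler_piMr (ltW s0))// norm_delta_le1.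
  by rewrite (le_lt_trans _ th)// gtr0_norm// (ler_piMr (ltW t0))// norm_delta_le1.
rewrite [LHS]Es /F partialB; [|exact: C1_diff (C1_translate _ _)|exact: C1_diff].
by rewrite partial_translate Et mulrA.
Qed.

Lemma ler_dist_halves (a b c e : R) :
  `|a - c| < e / 2 -> `|b - c| < e / 2 -> `|a - b| <= e.
Proof.
move=> ac bc; rewrite (le_trans (ler_distD c _ _))// (splitr e) lerD// ltW//.
by rewrite distrC.
Qed.

(** Schwarz: the second differences for (k, l) and (l, k) agree at every scale, so the
two mixed derivatives agree at points arbitrarily close to x, hence at x. *)
Lemma partial_comm f k l x : C2 f ->
  partial l (partial k f) x = partial k (partial l f) x.
Proof.
move=> C2f.
have cont a b : continuous (partial a (partial b f)).
  by case: C2f => _ H; exact: C1_partial_continuous.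
apply/eqP; rewrite -subr_eq0 -normr_le0; apply/ler_addgt0Pl => e e0; rewrite addr0.
have e20 : 0 < e / 2 by rewrite divr_gt0.
have /cvgrPdist_lt /(_ _ e20) /nbhs_ballP[d1 /= d10 H1] := cont l k x.
have /cvgrPdist_lt /(_ _ e20) /nbhs_ballP[d2 /= d20 H2] := cont k l x.
pose h := Num.min d1 d2 / 2.
have h0 : 0 < h by rewrite divr_gt0// lt_min d10.
have [y1 [yx1 E1]] := second_difference k l x C2f h0.
have [y2 [yx2 E2]] := second_difference l k x C2f h0.
have Eh : 2 * h = Num.min d1 d2 by rewrite /h mulrC divfK.
have {}H1 := H1 y1; have {}H2 := H2 y2.
have E : partial l (partial k f) y1 = partial k (partial l f) y2.
  have hh : h ^+ 2 != 0 by rewrite expf_neq0// gt_eqF.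
  apply: (mulfI hh); rewrite -E1 -E2 (addrAC x (h *: e_ l)).
  by ring.
move: yx1 yx2; rewrite Eh !lt_min => /andP[yx1 _] /andP[_ yx2].
have {}H1 : `|partial l (partial k f) x - partial l (partial k f) y1| < e / 2.
  by apply: H1; rewrite -ball_normE/= distrC.
have {}H2 : `|partial k (partial l f) x - partial k (partial l f) y2| < e / 2.
  by apply: H2; rewrite -ball_normE/= distrC.
by rewrite E in H1; exact: ler_dist_halves H1 H2.
Qed.

End Calculus.

Section ChainRule.
Context {R : realType} {n m : nat}.

Lemma differentiable_components (u : 'rV[R]_n -> 'rV[R]_m) x :
  (forall i, differentiable (component u i) x) -> differentiable u x.
Proof.
move=> dU.
have -> : u = \sum_(j < m) (fun y => component u j y *: (delta_mx 0 j : 'rV[R]_m)).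
  apply/funext => y; rewrite fct_sumE; apply/rowP => i.
  rewrite summxE (bigD1 i)//= big1 ?addr0; first by rewrite !mxE !eqxx mulr1.
  by move=> j ji; rewrite !mxE eqxx/= eq_sym (negbTE ji) mulr0.
by apply: differentiable_sum => j; exact: differentiableZl.
Qed.

(** The differential of u is read off its components, then composed with that of
H on the basis vectors. *)
Lemma partial_chain (H : 'rV[R]_m -> R) (u : 'rV[R]_n -> 'rV[R]_m) x :
  differentiable H (u x) -> (forall i, differentiable (component u i) x) ->
  differentiable (H \o u) x /\
  forall k, partial k (H \o u) x = \sum_j partial j H (u x) * partial k (component u j) x.
Proof.
move=> dH dU; have du := differentiable_components dU.
have dHu : differentiable (H \o u) x by exact: differentiable_comp.
split=> // k; rewrite /partial deriveE// diff_comp//=.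
have -> : 'd u x (delta_mx 0 k) = \sum_j partial k (component u j) x *: delta_mx 0 j.
  rewrite -deriveE// derive_mx; last exact: diff_derivable.
  apply/rowP => i; rewrite summxE mxE (bigD1 i)//= big1 ?addr0.
    by rewrite !mxE !eqxx mulr1.
  by move=> j ji; rewrite !mxE eqxx/= eq_sym (negbTE ji) mulr0.
rewrite linear_sum; apply: eq_bigr => j _.
by rewrite linearZ/= -deriveE// mulrC.
Qed.

Lemma C1_chain (H : 'rV[R]_m -> R) (u : 'rV[R]_n -> 'rV[R]_m) :
  C1 H -> (forall i, C1 (component u i)) -> C1 (H \o u).
Proof.
move=> cH cU.
have Hx x := @partial_chain H u x (C1_diff _ cH) (fun i => C1_diff x (cU i)).
have cu : continuous u.
  move=> x; apply: differentiable_continuous; apply: differentiable_components => i.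
  exact: C1_diff.
split=> [x|k]; first by have [] := Hx x.
rewrite (_ : partial k _ = fun x => \sum_j partial j H (u x) * partial k (component u j) x).
  apply: Cont_sum => j _; apply: ContM; last exact: C1_partial_continuous.
  move=> x; apply: continuous_comp; first exact: cu.
  exact: C1_partial_continuous.
by apply/funext => x; have [_ ->] := Hx x.
Qed.
End ChainRule.

(** * Integration by parts and the weakly differentiated equation *)

Section IntegrationByParts.
Context {R : realType} {n : nat}.
Local Notation rV := 'rV[R]_n.
Local Notation I f := (integral_Rn setT f).
Implicit Types (f g w psi : rV -> R) (x : rV) (k : 'I_n).
Local Notation e_ k := (delta_mx 0 k : rV).

Lemma ContN f : continuous f -> continuous (fun x => - f x).
Proof. by move=> cf x; exact: (cvgN (cf x)). Qed.

Lemma C1c_Cc f : C1c f -> Cc f.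
Proof.
move=> [cf cK]; split; first exact: C1_continuous.
have [M [_ HM]] := compact_bounded cK.
exists (M + 1) => x Mx; apply: contra_ltP Mx => /eqP fx.
by apply: HM; [rewrite ltrDl|apply: subset_closure; exact: fx].
Qed.

Lemma partial_near0 f k x : (\forall y \near x, f y = 0) -> partial k f x = 0.
Proof.
move=> f0; rewrite /partial -(derive_cst (0 : R) (e_ k) x).
by apply: near_eq_derive => //; near=> y; near: y.
Unshelve. all: by end_near. Qed.

Lemma Cc_partial f k : C1 f -> Cc f -> Cc (partial k f).
Proof.
move=> cf [_ [r fr]]; split; first exact: C1_partial_continuous.
exists r => x rx; apply: partial_near0.
have : \forall y \near x, r < `|y|.
  have /cvgr_gt := @norm_continuous _ rV x; exact.
by apply: filterS => y; exact: fr.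
Qed.

Lemma C1c_sub f g : C1c f -> C1 g -> (forall x, f x = 0 -> g x = 0) -> C1c g.
Proof.
move=> [cf cK] cg fg; split=> //.
apply: subclosed_compact cK _; first exact: closed_closure.
by apply: closure_subset => x /=; apply: contra_neq; exact: fg.
Qed.

(** Difference quotients are taken along a sequence of steps, which is the form of
limit that dominated convergence handles. *)
Definition step (j : nat) : R := j.+1%:R^-1.

Lemma step_gt0 j : 0 < step j. Proof. by rewrite invr_gt0. Qed.

Lemma step_le1 j : step j <= 1. Proof. by rewrite invf_le1// ler1n. Qed.

Definition dquot k j f x : R := (step j)^-1 * (f (x + step j *: e_ k) - f x).

Lemma dquot_cvg k f x : C1 f -> dquot k j f x @[j --> \oo] --> partial k f x.
Proof.
move=> cf; have df : derivable f x (e_ k) by apply: diff_derivable; exact: C1_diff.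
rewrite /derivable in df; have /cvgr_dnbhsP H := df.
have {}H := H step (conj (fun j => lt0r_neq0 (step_gt0 j)) (@cvg_harmonic R)).
rewrite [X in X @ \oo --> _](_ : _ = (fun j => (step j)^-1 *: ((f \o shift x) (step j *: e_ k) - f x)))//.
by apply/funext => j; rewrite /dquot /= [x + _]addrC.
Qed.

Lemma C1_dquot k j f : C1 f -> C1 (dquot k j f).
Proof.
move=> cf; apply: C1M; first exact: C1_cst.
by apply: C1B => //; exact: C1_translate.
Qed.

Lemma partial_dquot k l j f x : C1 f ->
  partial l (dquot k j f) x = dquot k j (partial l f) x.
Proof.
move=> cf; have ct := C1_translate (step j *: e_ k) cf.
rewrite partialM; [|exact: differentiable_cst|exact: C1_diff (C1B ct cf)].
rewrite partial_cst mulr0 addr0 partialB; [|exact: C1_diff|exact: C1_diff].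
by rewrite partial_translate.
Qed.

(** By the mean value theorem, difference quotients with steps at most 1 are bounded
uniformly in the step, which is what dominated convergence asks for. *)
Lemma dquot_bound k f r : C1 f ->
  exists M, forall j x, `|x| <= r -> `|dquot k j f x| <= M.
Proof.
move=> cf; have [M M0 HM] := bounded_on_ball (r + 1) (C1_partial_continuous (k := k) cf).
exists M => j x xr.
have [s /andP[s0 sj] Es] := @MVT_line R n f k x (step j) (fun y => C1_diff y cf) (step_gt0 j).
rewrite /dquot Es mulKf ?gt_eqF ?step_gt0//; apply: HM.
rewrite (le_trans (ler_normD _ _))// lerD// normrZ gtr0_norm//.
rewrite -[leRHS]mulr1 ler_pM// ?norm_delta_le1// ?ltW//.
by rewrite (lt_le_trans sj)// step_le1.
Qed.

Lemma Int_dquot_cvg k f w : C1 f -> Cc w ->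
  I (fun x => dquot k j f x * w x) @[j --> \oo] --> I (fun x => partial k f x * w x).
Proof.
move=> cf [cw [r0 wr0]]; pose r := `|r0|; have r_ge0 : 0 <= r by exact: normr_ge0.
have wr x : r < `|x| -> w x = 0 by move=> /(le_lt_trans (ler_norm _)) /wr0.
have [M HM] := dquot_bound k r cf.
have [N N0 HN] := bounded_on_ball r cw.
apply: (@Int_dominated_cvg R n _ _ r (M * N)) => //.
- by move=> j; apply: ContM => //; exact: C1_continuous (C1_dquot k j cf).
- by move=> j x rx; rewrite wr// mulr0.
- by move=> j x xr; rewrite normrM ler_pM//; [exact: HM|exact: HN].
- by move=> x; apply: cvgM; [exact: dquot_cvg|exact: cvg_cst].
Qed.

(** The difference quotients of f have integral 0 by translation invariance, and
they converge boundedly to the derivative. *)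
Lemma Int_partial f k : C1 f -> Cc f -> I (partial k f) = 0.
Proof.
move=> cf [_ [r0 fr0]]; pose r := `|r0| + 1.
have fr x : `|r0| < `|x| -> f x = 0 by move=> /(le_lt_trans (ler_norm _)) /fr0.
have r_ge0 : 0 <= r by rewrite addr_ge0.
have [M HM] := dquot_bound k r cf.
have H : I (dquot k j f) @[j --> \oo] --> I (partial k f).
  apply: (@Int_dominated_cvg R n _ _ r M) => //.
  - by move=> j; exact: C1_continuous (C1_dquot k j cf).
  - move=> j x rx; rewrite /dquot [f x]fr ?(lt_trans _ rx) ?ltrDl//.
    rewrite fr ?subrr ?mulr0//.
    have : `|x| <= `|x + step j *: e_ k| + `|step j *: e_ k|.
      by rewrite -{1}[x](addrK (step j *: e_ k)) ler_normB.
    have : `|step j *: e_ k| <= 1.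
      rewrite normrZ gtr0_norm ?step_gt0// -[leRHS]mulr1.
      by rewrite ler_pM ?step_le1 ?norm_delta_le1// ltW// step_gt0.
    by move: rx; rewrite /r; lra.
  - by move=> x; exact: dquot_cvg.
have E j : I (dquot k j f) = 0.
  have Cf : Cc f by split; [exact: C1_continuous|exists r0].
  have Ct : Cc (fun x => f (x + step j *: e_ k)).
    split; first exact: C1_continuous (C1_translate _ cf).
    exists (r0 + `|step j *: e_ k|) => x rx; apply: fr0.
    have : `|x| <= `|x + step j *: e_ k| + `|step j *: e_ k|.
      by rewrite -{1}[x](addrK (step j *: e_ k)) ler_normB.
    by move: rx; lra.
  rewrite /dquot IntZ; last exact: CcB.
  by rewrite IntB// Int_translate ?subrr ?mulr0//; exact: C1_continuous.
have E' : (fun j => I (dquot k j f)) = cst 0 by apply/funext.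
by rewrite E' in H; exact: (cvg_unique (@Rhausdorff R) H (cvg_cst 0)).
Qed.

Lemma Int_by_parts (F : 'I_n -> rV -> R) psi : (forall l, C1 (F l)) ->
  C1 psi -> Cc psi ->
  I (fun x => \sum_l F l x * partial l psi x) =
  I (fun x => - (\sum_l partial l (F l) x) * psi x).
Proof.
move=> cF cpsi Cpsi.
have CF l : Cc (fun x => F l x * psi x) by apply: CcMl => //; exact: C1_continuous.
have C1F l : C1 (fun x => F l x * psi x) by exact: C1M.
have C1' : Cc (fun x => \sum_l F l x * partial l psi x).
  by apply: Cc_sum => l _; apply: CcMl; [exact: C1_continuous|exact: Cc_partial].
have C2' : Cc (fun x => - (\sum_l partial l (F l) x) * psi x).
  apply: CcMl => //; apply: ContN; apply: Cont_sum => l _.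
  exact: C1_partial_continuous.
apply/eqP; rewrite -subr_eq0 -IntB//.
under eq_fun do rewrite mulNr opprK mulr_suml -big_split/=.
rewrite Int_sum => [|l _]; last first.
  apply: CcD; first by apply: CcMl; [exact: C1_continuous|exact: Cc_partial].
  by apply: CcMl => //; exact: C1_partial_continuous.
apply/eqP; rewrite big1// => l _; rewrite -[RHS](@Int_partial _ l (C1F l) (CF l)).
congr integral_Rn; apply/funext => x; rewrite partialM; try exact: C1_diff.
by rewrite [psi x * _]mulrC.
Qed.

Lemma cvg_sumr (T : Type) (s : seq T) (a : T -> nat -> R) (l : T -> R) :
  (forall i, a i j @[j --> \oo] --> l i) ->
  \sum_(i <- s) a i j @[j --> \oo] --> \sum_(i <- s) l i.
Proof.
move=> al; elim: s => [|i s IH].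
  rewrite big_nil (_ : (fun j => _) = cst 0); first exact: cvg_cst.
  by apply/funext => j; rewrite big_nil.
rewrite big_cons (_ : (fun j => _) = (fun j => a i j + \sum_(t <- s) a t j)).
  exact: (cvgD (al i) IH).
by apply/funext => j; rewrite big_cons.
Qed.

(** Integrating by parts for the difference quotients of F, and letting the step tend to
0 afterwards, never differentiates psi twice: it may be of class C^1 only, as the test
functions built from first derivatives of a C^2 function are. *)
Lemma differentiated_weak (F : 'I_n -> rV -> R) (h psi : rV -> R) k :
  (forall l, C1 (F l)) -> C1 h ->
  (forall x, - \sum_l partial l (F l) x = h x) ->
  C1 psi -> Cc psi ->
  I (fun x => \sum_l partial k (F l) x * partial l psi x) =
  I (fun x => partial k h x * psi x).
Proof.
move=> cF ch eqF cpsi Cpsi.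
have H1 : I (fun x => dquot k j h x * psi x) @[j --> \oo] -->
    I (fun x => partial k h x * psi x) by exact: Int_dquot_cvg.
have H2 : I (fun x => \sum_l dquot k j (F l) x * partial l psi x) @[j --> \oo] -->
    I (fun x => \sum_l partial k (F l) x * partial l psi x).
  rewrite Int_sum => [|l _]; last first.
    by apply: CcMl; [exact: C1_partial_continuous|exact: Cc_partial].
  have -> : (fun j => I (fun x => \sum_l dquot k j (F l) x * partial l psi x)) =
      (fun j => \sum_l I (fun x => dquot k j (F l) x * partial l psi x)).
    apply/funext => j; rewrite Int_sum// => l _.
    by apply: CcMl; [exact: C1_continuous (C1_dquot _ _ _)|exact: Cc_partial].
  by apply: cvg_sumr => l; apply: Int_dquot_cvg => //; exact: Cc_partial.
apply: (cvg_unique (@Rhausdorff R) H2); rewrite (_ : (fun j => _) = (fun j => I (fun x => dquot k j h x * psi x))) //.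
apply/funext => j; rewrite Int_by_parts//; last by move=> l; exact: C1_dquot.
congr integral_Rn; apply/funext => x; congr (_ * _).
under eq_bigr do rewrite partial_dquot//.
rewrite /dquot -mulr_sumr -mulrN sumrB opprB -!eqF opprK addrC.
by [].
Qed.
End IntegrationByParts.

(** * Extending C^1 functions on the half-line *)

Section Extension.
Context {R : realType}.

Lemma derivable_nneg_dist (g : R -> R) s : derivable_nneg g s ->
  forall e, 0 < e -> exists2 d, 0 < d &
  forall t, 0 <= t -> t != s -> `|t - s| < d ->
    `|derive_nneg g s - (g t - g s) / (t - s)| < e.
Proof.
move=> dg e e0.
have : quotient_at g s @ within [set t | 0 <= t] s^' --> derive_nneg g s by exact: dg.
move=> /cvgrPdist_lt /(_ e e0) [d /= d0 Hd]; exists d => // t t0 ts td.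
by apply: Hd => //=; rewrite /ball_/= distrC.
Qed.

(** The extension follows the tangent at 0.  It makes the usual chain rule available for
the composition with |grad u|^2, including at the critical points of u. *)
Lemma C1_extend (g : R -> R) : (forall s, 0 <= s -> derivable_nneg g s) ->
  {within [set t | 0 <= t], continuous (derive_nneg g)} ->
  exists p q : R -> R, [/\ forall s, 0 <= s -> p s = g s,
    forall s, 0 <= s -> q s = derive_nneg g s,
    forall s : R, is_derive s 1 p (q s) & continuous q].
Proof.
move=> dg cg.
pose p s := g (Num.max s 0) + derive_nneg g 0 * Num.min s 0.
pose q s := derive_nneg g (Num.max s 0).
have pE s : 0 <= s -> p s = g s by move=> s0; rewrite /p max_l// min_r// mulr0 addr0.
have pN s : s <= 0 -> p s = g 0 + derive_nneg g 0 * s.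
  by move=> s0; rewrite /p max_r// min_l.
have qE s : 0 <= s -> q s = derive_nneg g s by move=> s0; rewrite /q max_l.
exists p, q; split => //.
  move=> s.
  have H : h^-1 *: ((p \o shift s) (h *: 1) - p s) @[h --> (0 : R)^'] --> q s.
    apply/cvgrPdist_lt => e e0.
    suff [d d0 Hd] : exists2 d, 0 < d & forall t, t != s -> `|t - s| < d ->
        `|q s - (p t - p s) / (t - s)| < e.
      exists d => //= h; rewrite /ball_/= sub0r normrN => hd h0.
      have := Hd (h + s); rewrite addrK [h *: 1]mulr1 [h^-1 *: _]mulrC; apply => //.
      by rewrite -subr_eq0 addrK.
    have [s0|s0] := leP 0 s; last first.
      exists (- s); first by rewrite oppr_gt0.
      move=> t ts; rewrite ltr_norml => /andP[_ tN].
      have t0 : t <= 0 by move: tN; lra.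
      rewrite !pN// ?ltW// /q max_r ?ltW//.
      rewrite (_ : _ / _ = derive_nneg g 0) ?subrr ?normr0//.
      by field; rewrite subr_eq0.
    have [d d0 Hd] := derivable_nneg_dist (dg s s0) e0.
    exists (if s == 0 then d else Num.min d s).
      by case: eqVneq => // sn0; rewrite lt_min d0 lt_def sn0.
    move=> t ts; have [t0 td|t0] := leP 0 t.
      rewrite qE// !pE//; apply: Hd => //; apply: lt_le_trans td _.
      by case: ifP => // _; rewrite ge_min lexx.
    case: eqVneq => [s00 _|sn0].
      rewrite s00 qE// pN ?ltW// pE// subr0.
      rewrite (_ : _ / _ = derive_nneg g 0) ?subrr ?normr0//.
      by field; rewrite lt_eqF.
    by rewrite lt_min => /andP[_]; rewrite ltr_norml => /andP[]; lra.
  apply: DeriveDef; first by apply/cvg_ex; exists (q s).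
  exact: (cvg_lim (@Rhausdorff R) H).
move=> s.
have mx : continuous (fun x : R => Num.max x 0).
  have cid : continuous (id : R -> R^o) by move=> y; exact: cvg_id.
  have c0 : continuous (cst 0 : R -> R^o) by exact: cst_continuous.
  by move=> x; exact: (continuous_max (cid x) (c0 x)).
apply/cvgrPdist_lt => e e0.
have m0 : [set t | 0 <= t] (Num.max s 0) by rewrite /= le_max lexx orbT.
have cw := proj1 (subspace_continuousP _ _) cg.
have := cw _ m0.
move=> /cvgrPdist_lt /(_ e e0) H.
have {}H : \forall x \near s, 0 <= Num.max x 0 -> `|q s - q x| < e := mx s _ H.
near=> x; have Hx : 0 <= Num.max x 0 by rewrite le_max lexx orbT.
by move: Hx; near: x.
Unshelve. all: by end_near. Qed.

Lemma C2_nneg_extend (f : R -> R) : C2_nneg f ->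
  exists p q : R -> R, [/\ forall s, 0 <= s -> p s = derive_nneg f s,
    forall s, 0 <= s -> q s = derive_nneg (derive_nneg f) s,
    forall s : R, is_derive s 1 p (q s) & continuous q].
Proof. by move=> [_ d2 c2]; exact: C1_extend. Qed.
End Extension.

(** * Euclidean geometry and the tangential part of a Hessian *)

Section Euclidean.
Context {R : realType} {n : nat}.
Implicit Types (v w z nu d : 'rV[R]_n).

Lemma dotC v w : dot v w = dot w v.
Proof. by apply: eq_bigr => k _; rewrite mulrC. Qed.

Lemma dotDl v w z : dot (v + w) z = dot v z + dot w z.
Proof. by rewrite /dot -big_split/=; apply: eq_bigr => k _; rewrite mxE mulrDl. Qed.

Lemma dotZl a v w : dot (a *: v) w = a * dot v w.
Proof. by rewrite /dot mulr_sumr; apply: eq_bigr => k _; rewrite mxE mulrA. Qed.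

Lemma dotNl v w : dot (- v) w = - dot v w.
Proof. by rewrite -scaleN1r dotZl mulN1r. Qed.

Lemma dotBl v w z : dot (v - w) z = dot v z - dot w z.
Proof. by rewrite dotDl dotNl. Qed.

Lemma dotDr v w z : dot z (v + w) = dot z v + dot z w.
Proof. by rewrite dotC dotDl !(dotC z). Qed.

Lemma dotZr a v w : dot w (a *: v) = a * dot w v.
Proof. by rewrite dotC dotZl (dotC w). Qed.

Lemma dotNr v w : dot w (- v) = - dot w v.
Proof. by rewrite dotC dotNl (dotC w). Qed.

Lemma dotBr v w z : dot z (v - w) = dot z v - dot z w.
Proof. by rewrite dotDr dotNr. Qed.

Lemma dot0l v : dot 0 v = 0.
Proof. by rewrite /dot big1// => k _; rewrite mxE mul0r. Qed.

Lemma dot_suml (T : Type) (s : seq T) (P : pred T) (F : T -> 'rV[R]_n) w :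
  dot (\sum_(i <- s | P i) F i) w = \sum_(i <- s | P i) dot (F i) w.
Proof. by elim/big_rec2 : _ => [|i y z _ <-]; rewrite ?dot0l// dotDl. Qed.

Lemma dot_ge0 v : 0 <= dot v v.
Proof. by apply: sumr_ge0 => k _; rewrite -expr2 sqr_ge0. Qed.

Lemma dot_eq0 v : dot v v = 0 -> v = 0.
Proof.
move=> v0; apply/rowP => k; rewrite mxE; apply/eqP.
have : dot v v == 0 by rewrite v0.
rewrite psumr_eq0 => [/allP/(_ k)|i _]; last by rewrite -expr2 sqr_ge0.
by rewrite mem_index_enum => /(_ isT); rewrite -expr2 sqrf_eq0.
Qed.

Lemma sqr_enorm v : enorm v ^+ 2 = dot v v.
Proof. by rewrite sqr_sqrtr// dot_ge0. Qed.

Lemma enorm_neq0 v : (enorm v != 0) = (dot v v != 0).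
Proof. by rewrite -sqr_enorm sqrf_eq0. Qed.

Lemma cauchy_schwarz d v : dot d v ^+ 2 <= dot d d * dot v v.
Proof.
have [d0|dN0] := eqVneq (dot d d) 0.
  by rewrite (dot_eq0 d0) !dot0l mul0r expr0n.
have d0 : 0 < dot d d by rewrite lt_def dN0 dot_ge0.
have := dot_ge0 (dot d d *: v - dot d v *: d).
rewrite !(dotBl, dotBr, dotZl, dotZr) (dotC v d) => H.
by rewrite -subr_ge0 -(pmulr_rge0 _ d0); apply: le_trans H _; rewrite le_eqVlt; apply/orP; left; apply/eqP; ring.
Qed.

(** Expand the squared distance of v to its projection on the span of the family. *)
Lemma bessel r (e : 'I_r -> 'rV[R]_n) v :
  (forall a b, dot (e a) (e b) = (a == b)%:R) ->
  \sum_a dot v (e a) ^+ 2 <= dot v v.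
Proof.
move=> oe; pose y := \sum_a dot v (e a) *: e a.
have yv : dot y v = \sum_a dot v (e a) ^+ 2.
  by rewrite /y dot_suml; apply: eq_bigr => a _; rewrite dotZl dotC expr2.
have yy : dot y y = \sum_a dot v (e a) ^+ 2.
  rewrite {1}/y dot_suml; apply: eq_bigr => a _; rewrite dotZl [dot (e a) y]dotC /y dot_suml.
  rewrite (bigD1 a)//= big1 ?addr0 => [|b ba]; last by rewrite dotZl oe (negbTE ba) mulr0.
  by rewrite dotZl oe eqxx mulr1 expr2.
have := dot_ge0 (v - y); rewrite !(dotBl, dotBr) (dotC v y) yy yv.
lra.
Qed.

(** The bilinear form of the matrix A(d), with p and q for the values of Phi' and
Phi'' at |d|^2. *)
Definition Aform (p q : R) d v w : R := 2 * q * dot d v * dot d w + p * dot v w.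

(** When q < 0 the form is smallest in the direction of d, where it is
(p + 2 q |d|^2) |v|^2: this is Cauchy-Schwarz. *)
Lemma Aform_ge0 p q d v : 0 <= p -> 0 <= p + 2 * dot d d * q -> 0 <= Aform p q d v v.
Proof.
move=> p0 pq0; rewrite /Aform -[_ * dot d v * _]mulrA -expr2.
have CS := cauchy_schwarz d v; have v0 := dot_ge0 v.
have [q0|q0] := leP 0 q.
  by rewrite addr_ge0// mulr_ge0 ?sqr_ge0// mulr_ge0.
have : 2 * q * (dot d d * dot v v) <= 2 * q * dot d v ^+ 2.
  by rewrite ler_nM2l//; lra.
have := mulr_ge0 pq0 v0; lra.
Qed.

Lemma Aform_Amx (Phi : R -> R) d v w :
  dot (Amx Phi d *m v^T)^T w =
  Aform (derive_nneg Phi (dot d d)) (derive_nneg (derive_nneg Phi) (dot d d)) d v w.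
Proof.
rewrite /Aform {1}/dot.
have E k : (Amx Phi d *m v^T)^T 0 k =
    2 * derive_nneg (derive_nneg Phi) (dot d d) * dot d v * d 0 k +
    derive_nneg Phi (dot d d) * v 0 k.
  rewrite !mxE.
  under eq_bigr do rewrite !mxE sqr_enorm mulrDl.
  rewrite big_split/= [X in _ + X](bigD1 k)//= [X in _ + (_ + X)]big1 ?addr0; last first.
    by move=> j jk; rewrite eq_sym (negbTE jk) mulr0 mul0r.
  rewrite eqxx mulr1 /dot mulr_sumr mulr_suml; congr (_ + _).
  by apply: eq_bigr => j _; ring.
under eq_bigr do rewrite E mulrDl.
rewrite big_split/= /dot !mulr_sumr; congr (_ + _); apply: eq_bigr => k _; ring.
Qed.

Section Hessian.
Variables (D : 'I_n -> 'rV[R]_n) (nu : 'rV[R]_n).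
Hypothesis symD : forall k l, D k 0 l = D l 0 k.
Hypothesis nu1 : dot nu nu = 1.

Definition hess_apply v : 'rV[R]_n := \row_k dot (D k) v.

Let w := hess_apply nu.
Let c := dot nu w.

(** The rows of P D P, where P is the orthogonal projection along nu: up to the factor
|grad u|, this is the second fundamental form of the level set. *)
Definition tangential_hess k : 'rV[R]_n :=
  D k - w 0 k *: nu - nu 0 k *: (w - c *: nu).

Lemma hess_sym v z : dot (hess_apply v) z = dot v (hess_apply z).
Proof.
rewrite /dot; under eq_bigr do rewrite mxE mulr_suml.
rewrite exchange_big/=; apply: eq_bigr => l _; rewrite mxE /dot mulr_sumr.
by apply: eq_bigr => k _; rewrite symD; ring.
Qed.

Lemma sum_hess v : \sum_k v 0 k *: D k = hess_apply v.
Proof.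
apply/rowP => l; rewrite summxE mxE; apply: eq_bigr => k _.
by rewrite mxE symD mulrC.
Qed.

(** Pythagoras: D is the orthogonal sum of c nu nu^T, of the two symmetric copies of the
tangential part of w, and of P D P, so |D|^2 = c^2 + 2 (|w|^2 - c^2) + |P D P|^2. *)
Lemma tangential_hess_sqr :
  \sum_k dot (tangential_hess k) (tangential_hess k) =
  \sum_k dot (D k) (D k) - 2 * dot w w + c ^+ 2.
Proof.
pose y := w - c *: nu.
have wn : dot w nu = c by rewrite dotC.
have yE : y = w - c *: nu by [].
clearbody y.
have yn : dot nu y = 0 by rewrite yE dotBr dotZr nu1 mulr1 subrr.
have yy : dot y y = dot w w - c ^+ 2.
  by rewrite {1}yE dotBl dotZl yn mulr0 subr0 yE dotBr dotZr wn expr2.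
have wy : dot w y = dot w w - c ^+ 2 by rewrite yE dotBr dotZr wn expr2.
have E k : dot (tangential_hess k) (tangential_hess k) =
    dot (D k) (D k) - w 0 k * w 0 k + nu 0 k * nu 0 k * dot y y
    - 2 * (nu 0 k * hess_apply y 0 k).
  have Dn : dot (D k) nu = w 0 k by rewrite /w mxE.
  rewrite [hess_apply y 0 k]mxE /tangential_hess -yE !(dotBl, dotBr, dotZl, dotZr).
  by rewrite yn (dotC nu (D k)) (dotC y nu) (dotC y (D k)) yn Dn nu1; ring.
under eq_bigr do rewrite E.
rewrite !(sumrB, big_split)/= -mulr_suml -mulr_sumr.
rewrite -/(dot w w) -/(dot nu nu) -/(dot nu (hess_apply y)) nu1 -hess_sym -/w.
by rewrite wy yy; ring.
Qed.

(** The third hypothesis is the form taken by the Weingarten map: differentiating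
|grad u|^-1 grad u gives h^-1 D, up to a multiple of nu.  Projecting it on the tangent
space shows that e a is an eigenvector of P D P for - h kappa a, and Bessel applied
to the rows of P D P gives the bound. *)
Lemma sum_curvature_le r (e : 'I_r -> 'rV[R]_n) (kappa : 'I_r -> R) (h : R) (s : 'I_r -> R) :
  (forall a b, dot (e a) (e b) = (a == b)%:R) ->
  (forall a, dot (e a) nu = 0) ->
  (forall a, - (h^-1 *: hess_apply (e a) + s a *: nu) = kappa a *: e a) -> h != 0 ->
  h ^+ 2 * \sum_a kappa a ^+ 2 <= \sum_k dot (D k) (D k) - 2 * dot w w + c ^+ 2.
Proof.
move=> oe ne He h0; rewrite -tangential_hess_sqr.
have De a : hess_apply (e a) = - (h * kappa a) *: e a - (h * s a) *: nu.
  move: (He a); move: (hess_apply (e a)) => X HX; apply/rowP => l.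
  have := congr1 (fun v : 'rV[R]_n => v 0 l) HX; rewrite !mxE => El.
  rewrite -[LHS](mulVKf h0) (_ : h^-1 * X 0 l = - (kappa a * e a 0 l) - s a * nu 0 l).
    by ring.
  by rewrite -El opprK addrK.
have we a : dot w (e a) = - (h * s a).
  rewrite hess_sym De dotBr !dotZr (dotC nu (e a)) ne nu1; ring.
have Me a k : dot (tangential_hess k) (e a) = - (h * kappa a) * e a 0 k.
  rewrite /tangential_hess !(dotBl, dotZl) (dotC nu (e a)) ne we.
  have -> : dot (D k) (e a) = hess_apply (e a) 0 k by rewrite mxE.
  by rewrite De !mxE; ring.
apply: (@le_trans _ _ (\sum_k \sum_a dot (tangential_hess k) (e a) ^+ 2)); last first.
  by apply: ler_sum => k _; exact: bessel.
rewrite exchange_big/= mulr_sumr; apply: ler_sum => a _.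
under eq_bigr do rewrite Me exprMn sqrrN expr2 [e a _ _ ^+ 2]expr2.
by rewrite -mulr_sumr -/(dot (e a) (e a)) oe eqxx mulr1 -expr2 exprMn.
Qed.

Lemma tangential_hess_ge0 : 0 <= \sum_k dot (D k) (D k) - 2 * dot w w + c ^+ 2.
Proof. by rewrite -tangential_hess_sqr; apply: sumr_ge0 => k _; exact: dot_ge0. Qed.
End Hessian.
End Euclidean.

(** * Geometry of the level sets *)

(** A sealed copy of the partial derivative: comparing two distinct partial
derivatives must fail at once, instead of unfolding both of them to limits. *)
HB.lock Definition pd (R : realType) n (k : 'I_n) (f : 'rV[R]_n -> R) x : R :=
  partial k f x.

Lemma partial_pd (R : realType) n : @partial R n = @pd R n.
Proof. by rewrite pd.unlock. Qed.

Definition gd (R : realType) n (f : 'rV[R]_n -> R) x : 'rV[R]_n := \row_k pd k f x.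

Lemma grad_gd (R : realType) n : @grad R n = @gd R n.
Proof. by rewrite /gd -partial_pd. Qed.

Lemma gdE (R : realType) n (f : 'rV[R]_n -> R) x k : gd f x 0 k = pd k f x.
Proof. exact: mxE. Qed.

Section SealedRules.
Context {R : realType} {n : nat}.
Implicit Types (f g : 'rV[R]_n -> R).

Lemma pdM k f g x : differentiable f x -> differentiable g x ->
  pd k (fun y => f y * g y) x = f x * pd k g x + g x * pd k f x.
Proof. by rewrite -partial_pd; exact: partialM. Qed.

Lemma pd_sum (T : Type) (s : seq T) (F : T -> 'rV[R]_n -> R) x k :
  (forall i, differentiable (F i) x) ->
  pd k (fun y => \sum_(i <- s) F i y) x = \sum_(i <- s) pd k (F i) x.
Proof. by rewrite -partial_pd => dF; have [_] := partial_sum s dF. Qed.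

Lemma pdV k f x : f x != 0 -> differentiable f x ->
  pd k (fun y => (f y)^-1) x = - (f x ^- 2) * pd k f x.
Proof. by rewrite -partial_pd; exact: partialV. Qed.

Lemma pd_comp (h : R -> R) dh f x k : is_derive (f x) 1 h dh ->
  differentiable f x -> pd k (h \o f) x = dh * pd k f x.
Proof. by rewrite -partial_pd => hd df; have [_] := partial_comp hd df. Qed.

Lemma C1_pd_continuous k f : C1 f -> continuous (pd k f).
Proof. by rewrite -partial_pd; exact: C1_partial_continuous. Qed.

Lemma C2_pd k f : C2 f -> C1 (pd k f).
Proof. by rewrite -partial_pd => -[]. Qed.

Lemma C2_C1 f : C2 f -> C1 f. Proof. by case. Qed.

Lemma pd_comm k l f x : C2 f -> pd l (pd k f) x = pd k (pd l f) x.
Proof. by rewrite -partial_pd; exact: partial_comm. Qed.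

Lemma derive_gd f x v : differentiable f x -> 'D_v f x = dot (gd f x) v.
Proof.
move=> df; rewrite deriveE//.
have {1}-> : v = \sum_k v 0 k *: delta_mx 0 k by exact: row_sum_delta.
rewrite linear_sum; apply: eq_bigr => k _.
by rewrite linearZ/= gdE -partial_pd /partial deriveE// mulrC.
Qed.
End SealedRules.

Section PointwiseAlgebra.
Context {R : realType} {n : nat}.
Variables (D : 'I_n -> 'rV[R]_n) (d : 'rV[R]_n) (h : R).
Hypotheses (h0 : h != 0) (hd : dot d d = h ^+ 2).

Let nu := h^-1 *: d.
Let w := hess_apply D nu.
Let c := dot nu w.

Lemma nu_unit : dot nu nu = 1.
Proof. by rewrite /nu dotZl dotZr hd; field. Qed.

Lemma hess_applyZ (a : R) v : hess_apply D (a *: v) = a *: hess_apply D v.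
Proof. by apply/rowP => k; rewrite !mxE dotZr. Qed.

Lemma hess_d : hess_apply D d = h *: w.
Proof. by rewrite /w hess_applyZ scalerA mulfV// scale1r. Qed.

Lemma AformC (p q : R) (v z : 'rV[R]_n) : Aform p q d v z = Aform p q d z v.
Proof. by rewrite /Aform (dotC v z); ring. Qed.

Lemma sum_Aform_hess (p q : R) :
  \sum_k Aform p q d (D k) (D k) = 2 * q * h ^+ 2 * dot w w + p * \sum_k dot (D k) (D k).
Proof.
rewrite big_split/= -mulr_sumr; congr (_ + _).
rewrite /dot mulr_sumr; apply: eq_bigr => k _.
have -> : \sum_l d 0 l * D k 0 l = h * w 0 k.
  by rewrite -/(dot d (D k)) dotC; have := congr1 (fun v : 'rV[R]_n => v 0 k) hess_d; rewrite !mxE.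
ring.
Qed.

(** Completing the square in the stability inequality: z is, up to the factor
h, the gradient of h eta minus h eta grad phi / phi. *)
Lemma stability_square (p q eta phi : R) (veta vphi : 'rV[R]_n) : phi != 0 ->
  let G := 2 *: hess_apply D d in
  let vpsi := phi^-1 *: (eta ^+ 2 *: G + (2 * h ^+ 2 * eta) *: veta)
              - (h ^+ 2 * eta ^+ 2 / phi ^+ 2) *: vphi in
  let z := (eta / h) *: w + veta - (eta / phi) *: vphi in
  h ^+ 2 * Aform p q d veta veta
  + (\sum_k Aform p q d (D k) (D k) * eta ^+ 2 + eta * Aform p q d G veta)
  - Aform p q d vphi vpsi =
  ((2 * q * h ^+ 2 + p) * (dot w w - c ^+ 2)
   + p * (\sum_k dot (D k) (D k) - 2 * dot w w + c ^+ 2)) * eta ^+ 2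
  + h ^+ 2 * Aform p q d z z.
Proof.
move=> phi0 G vpsi z; rewrite -mulr_suml sum_Aform_hess /vpsi /G hess_d /z /Aform.
rewrite !(dotBl, dotDl, dotZl, dotBr, dotDr, dotZr).
have -> : dot d w = h * c by rewrite /c /nu dotZl; field.
rewrite (dotC veta w) (dotC vphi w) (dotC vphi veta).
by field; rewrite phi0 h0.
Qed.
End PointwiseAlgebra.

Lemma sqr_tangential_part {R : realType} {n : nat} (v nu : 'rV[R]_n) :
  dot nu nu = 1 ->
  dot (v - dot v nu *: nu) (v - dot v nu *: nu) = dot v v - dot nu v ^+ 2.
Proof.
by move=> nu1; rewrite !(dotBl, dotBr, dotZl, dotZr) nu1 (dotC nu v); ring.
Qed.

Section OneComponent.
Context {R : realType} {n : nat}.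
Local Notation rV := 'rV[R]_n.
Variable (U : rV -> R).
Hypothesis C2U : C2 U.

Definition hess x k : rV := gd (pd k U) x.

Definition sqgrad x : R := dot (gd U x) (gd U x).

Lemma hess_symm x k l : hess x k 0 l = hess x l 0 k.
Proof. by rewrite /hess !gdE; exact: pd_comm. Qed.

Lemma C1_partial_U k : C1 (pd k U). Proof. exact: C2_pd. Qed.

Lemma sqgradE : sqgrad = fun x => \sum_k pd k U x * pd k U x.
Proof. by apply/funext => x; apply: eq_bigr => k _; rewrite gdE. Qed.

Lemma C1_sqgrad : C1 sqgrad.
Proof. by rewrite sqgradE; apply: C1_sum => k; apply: C1M; exact: C1_partial_U. Qed.

Lemma gd_sqgrad x : gd sqgrad x = 2 *: hess_apply (hess x) (gd U x).
Proof.
apply/rowP => l; rewrite gdE sqgradE pd_sum; last first.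
  by move=> k; apply: C1_diff; apply: C1M; exact: C1_partial_U.
rewrite 2!mxE /dot mulr_sumr; apply: eq_bigr => k _.
rewrite pdM; try exact: C1_diff (C1_partial_U k).
by rewrite hess_symm !gdE; ring.
Qed.

Section AtRegularPoint.
Variable x : rV.
Hypothesis reg : enorm (gd U x) != 0.
Let h := enorm (gd U x).
Let nu := normal U x.
Let w := hess_apply (hess x) nu.
Let c := dot nu w.

Lemma normalE : nu = h^-1 *: gd U x.
Proof. by rewrite /nu /normal grad_gd. Qed.

Lemma normal_unit : dot nu nu = 1.
Proof. by rewrite normalE; apply: nu_unit; rewrite ?sqr_enorm. Qed.

Lemma sqgrad_gt0 : 0 < sqgrad x.
Proof. by rewrite lt_def -enorm_neq0 reg dot_ge0. Qed.

Lemma differentiable_enorm_grad :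
  differentiable (fun y => enorm (gd U y)) x /\
  forall k, pd k (fun y => enorm (gd U y)) x = w 0 k.
Proof.
have ds := is_derive1_sqrt sqgrad_gt0.
have [Hd _] := @partial_comp R n Num.sqrt _ sqgrad x ds (C1_diff x C1_sqgrad).
split=> // k; rewrite (pd_comp k ds (C1_diff x C1_sqgrad)).
have := congr1 (fun v : rV => v 0 k) (gd_sqgrad x); rewrite gdE => ->.
rewrite /w normalE hess_applyZ -/h !mxE.
by rewrite /sqgrad -/(enorm (gd U x)) -/h; field.
Qed.

Lemma tangential_grad_sqr :
  enorm (tangential_grad U (fun y => enorm (gd U y)) x) ^+ 2 = dot w w - c ^+ 2.
Proof.
have nu1 := normal_unit.
rewrite sqr_enorm /tangential_grad -/nu grad_gd.
have -> : gd (fun y => enorm (gd U y)) x = w.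
  by apply/rowP => k; rewrite gdE; have [_ ->] := differentiable_enorm_grad.
exact: sqr_tangential_part.
Qed.

(** The component along nu is kept as the product rule gives it, since projecting on
the tangent space will remove it. *)
Lemma derive_normal v : 'D_v (normal U) x = h^-1 *: hess_apply (hess x) v +
  (h * 'D_v (fun y => (enorm (gd U y))^-1) x) *: nu.
Proof.
have [dh _] := differentiable_enorm_grad.
have dV : differentiable (fun y => (enorm (gd U y))^-1) x by exact: differentiableV.
have nE i k : (fun y => normal U y i k) = (fun y => (enorm (gd U y))^-1 * pd k U y).
  by apply/funext => y; rewrite (ord1 i) mxE grad_gd gdE.
have dN i k : differentiable (fun y => normal U y i k) x.
  by rewrite nE; apply: differentiableM => //; exact: C1_diff (C1_partial_U k).
rewrite derive_mx; last by apply/derivable_mxP => i k; exact: diff_derivable.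
have dU k : differentiable (pd k U) x by exact: C1_diff (C1_partial_U k).
apply/rowP => k; rewrite mxE nE deriveM; [|exact: diff_derivable|exact: diff_derivable].
rewrite (derive_gd v (dU k)) -/h normalE !mxE -/(hess x k) -/h.
congr (_ + _); move: ('D_v _ x) => s.
by rewrite /GRing.scale/=; field.
Qed.

(** If the point has no family of principal curvatures, the curvature term is 0 by
convention and the bound says that |P D P|^2 is nonnegative. *)
Lemma curvature_sq_bounds : 0 <= curvature_sq U x /\
  h ^+ 2 * curvature_sq U x <= \sum_k dot (hess x k) (hess x k) - 2 * dot w w + c ^+ 2.
Proof.
have nu1 := normal_unit.
rewrite /curvature_sq; case: xgetP => [s _ [kappa [[e [oe ne He]] ->]]|_].
  split; first by apply: sumr_ge0 => a _; exact: sqr_ge0.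
  apply: (sum_curvature_le (hess_symm x) nu1 oe ne _ reg) => a.
  by rewrite -He derive_normal.
by split=> //; rewrite mulr0; exact: tangential_hess_ge0 (hess_symm x) nu1.
Qed.
End AtRegularPoint.
End OneComponent.

(** * The tested equations for one component *)

Lemma Aform_suml {R : realType} {n : nat} (p q : R) (d w : 'rV[R]_n)
    (a : 'I_n -> R) (F : 'I_n -> 'rV[R]_n) :
  Aform p q d (\sum_k a k *: F k) w = \sum_k a k * Aform p q d (F k) w.
Proof.
rewrite /Aform (dotC d (\sum_k _)) !dot_suml.
rewrite [2 * q * \sum_i _]mulr_sumr [X in X + _]mulr_suml [p * _]mulr_sumr -big_split/=.
by apply: eq_bigr => k _; rewrite !dotZl (dotC _ d); ring.
Qed.

Lemma AformZl {R : realType} {n : nat} (p q : R) (d v w : 'rV[R]_n) (a : R) :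
  Aform p q d (a *: v) w = a * Aform p q d v w.
Proof. by rewrite /Aform dotZr dotZl; ring. Qed.

Section OneEquation.
Context {R : realType} {n : nat}.
Local Notation rV := 'rV[R]_n.
Local Notation I f := (integral_Rn setT f).
Variables (p q : R -> R).
Hypotheses (dp : forall s : R, is_derive s 1 p (q s)) (cq : continuous q).
Variable U : rV -> R.
Hypothesis C2U : C2 U.

Local Notation g := (sqgrad U).
Local Notation Hess := (hess U).
Local Notation A x := (Aform (p (g x)) (q (g x)) (gd U x)).

Lemma C1_pg : C1 (p \o g).
Proof. by apply: (C1_comp dp cq); exact: C1_sqgrad. Qed.

Lemma Cont_qg : continuous (q \o g).
Proof.
move=> x; apply: continuous_comp; last exact: cq.
by apply: C1_continuous; exact: C1_sqgrad.
Qed.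

Lemma Cont_dot (v w : rV -> rV) : (forall k, continuous (fun x => v x 0 k)) ->
  (forall k, continuous (fun x => w x 0 k)) -> continuous (fun x => dot (v x) (w x)).
Proof. by move=> cv cw; apply: Cont_sum => k _; exact: ContM. Qed.

Lemma Cont_gd (f : rV -> R) : C1 f -> forall k, continuous (fun x => gd f x 0 k).
Proof.
move=> cf k; rewrite (_ : (fun x => _) = pd k f); first exact: C1_pd_continuous.
by apply/funext => x; rewrite gdE.
Qed.

Lemma Cont_Aform (v w : rV -> rV) : (forall k, continuous (fun x => v x 0 k)) ->
  (forall k, continuous (fun x => w x 0 k)) -> continuous (fun x => A x (v x) (w x)).
Proof.
move=> cv cw; have cU := Cont_gd (C2_C1 C2U).
apply: ContD.
  apply: ContM; last exact: Cont_dot.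
  apply: ContM; last exact: Cont_dot.
  by apply: ContM; [exact: Cont_cst|exact: Cont_qg].
by apply: ContM; [exact: C1_continuous C1_pg|exact: Cont_dot].
Qed.

Lemma Cc_dot (v w : rV -> rV) : (forall k, continuous (fun x => v x 0 k)) ->
  (forall k, Cc (fun x => w x 0 k)) -> Cc (fun x => dot (v x) (w x)).
Proof. by move=> cv cw; apply: Cc_sum => k _; exact: CcMl. Qed.

Lemma Cc_Aform (v w : rV -> rV) : (forall k, continuous (fun x => v x 0 k)) ->
  (forall k, Cc (fun x => w x 0 k)) -> Cc (fun x => A x (v x) (w x)).
Proof.
move=> cv cw; have cU := Cont_gd (C2_C1 C2U).
apply: CcD.
  apply: CcMl; last exact: Cc_dot.
  apply: ContM; last exact: Cont_dot.
  by apply: ContM; [exact: Cont_cst|exact: Cont_qg].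
by apply: CcMl; [exact: C1_continuous C1_pg|exact: Cc_dot].
Qed.

Lemma Cc_gd (f : rV -> R) : C1 f -> Cc f -> forall k, Cc (fun x => gd f x 0 k).
Proof.
move=> cf Cf k; rewrite (_ : (fun x => _) = pd k f); last first.
  by apply/funext => x; rewrite gdE.
by rewrite -partial_pd; exact: Cc_partial.
Qed.

Lemma Cont_hess k l : continuous (fun x => Hess x k 0 l).
Proof. by apply: Cont_gd; exact: C2_pd. Qed.

(** Row k of the differentiated flux is A(grad u) grad (d_k u), which uses the symmetry
of the Hessian. *)
Lemma pd_flux k l x : pd k (fun y => p (g y) * pd l U y) x =
  2 * q (g x) * dot (gd U x) (Hess x k) * pd l U x + p (g x) * Hess x k 0 l.
Proof.
have dg := C1_diff x (C1_sqgrad C2U).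
rewrite pdM; [|exact: C1_diff C1_pg|exact: C1_diff (C2_pd _ C2U)].
rewrite (pd_comp k (dp (g x)) dg) -(gdE g) gd_sqgrad// hess_symm// gdE !mxE.
rewrite (dotC _ (gd U x)); ring.
Qed.

Lemma sum_flux k x (v : rV) :
  \sum_l pd k (fun y => p (g y) * pd l U y) x * v 0 l = A x (Hess x k) v.
Proof.
under eq_bigr do rewrite pd_flux mulrDl.
rewrite big_split/= /Aform {4}/dot {3}/dot !mulr_sumr; congr (_ + _).
  by apply: eq_bigr => l _; rewrite gdE !mulrA.
by apply: eq_bigr => l _; rewrite mulrA.
Qed.

Lemma gd_M (f f' : rV -> R) x : C1 f -> C1 f' ->
  gd (fun y => f y * f' y) x = f x *: gd f' x + f' x *: gd f x.
Proof.
move=> cf cf'; apply/rowP => k; rewrite !mxE pdM//; exact: C1_diff.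
Qed.

Lemma gd_sqr (f : rV -> R) x : C1 f ->
  gd (fun y => f y ^+ 2) x = (2 * f x) *: gd f x.
Proof.
move=> cf; rewrite (_ : (fun y => f y ^+ 2) = (fun y => f y * f y)); last first.
  by apply/funext => y; rewrite expr2.
by rewrite gd_M// -scalerDl -mulr2n mulr_natl.
Qed.

Lemma C1_sqr (f : rV -> R) : C1 f -> C1 (fun y => f y ^+ 2).
Proof.
move=> cf; rewrite (_ : (fun y => f y ^+ 2) = (fun y => f y * f y)); first exact: C1M.
by apply/funext => y; rewrite expr2.
Qed.

Lemma Cc_sqr (f : rV -> R) : Cc f -> Cc (fun y => f y ^+ 2).
Proof.
move=> cf; rewrite (_ : (fun y => f y ^+ 2) = (fun y => f y * f y)); last first.
  by apply/funext => y; rewrite expr2.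
by apply: CcMl => //; case: cf.
Qed.

Variables (h eta : rV -> R).
Hypotheses (C1eta : C1 eta) (Cceta : Cc eta).

(** The sum over k of A(grad d_k U, grad (d_k U eta^2)). *)
Definition linear_form x : R :=
  \sum_k A x (Hess x k) (Hess x k) * eta x ^+ 2 +
  eta x * A x (2 *: hess_apply (Hess x) (gd U x)) (gd eta x).

(** Test the equation differentiated in the direction k against d_k u eta^2, and sum
over k, using that sum_k d_k u grad (d_k u) is half the gradient of |grad u|^2. *)
Lemma linearized_tested : C1 h ->
  (forall x, - \sum_l pd l (fun y => p (g y) * pd l U y) x = h x) ->
  I linear_form = I (fun x => dot (gd h x) (gd U x) * eta x ^+ 2).
Proof.
move=> ch eqU.
pose psi k x := pd k U x * eta x ^+ 2.
have C1psi k : C1 (psi k) by apply: C1M; [exact: C2_pd|exact: C1_sqr].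
have Ccpsi k : Cc (psi k) by apply: CcMl; [exact: C1_continuous (C2_pd _ C2U)|exact: Cc_sqr].
have C1F l : C1 (fun y => p (g y) * pd l U y) by apply: C1M; [exact: C1_pg|exact: C2_pd].
have key k : I (fun x => A x (Hess x k) (gd (psi k) x)) = I (fun x => pd k h x * psi k x).
  have := @differentiated_weak R n (fun l y => p (g y) * pd l U y) h (psi k) k.
  rewrite partial_pd => /(_ C1F ch eqU (C1psi k) (Ccpsi k)) <-.
  congr integral_Rn; apply/funext => x; rewrite -sum_flux.
  by apply: eq_bigr => l _; rewrite gdE.
transitivity (I (fun x => \sum_k A x (Hess x k) (gd (psi k) x))).
  congr integral_Rn; apply/funext => x.
  have gpsi k : gd (psi k) x = (2 * eta x * pd k U x) *: gd eta x + eta x ^+ 2 *: Hess x k.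
    by rewrite gd_M ?gd_sqr//; [rewrite scalerA mulrC|exact: C2_pd|exact: C1_sqr].
  rewrite /linear_form -sum_hess; last by move=> k l; exact: hess_symm.
  have -> : A x (2 *: \sum_k gd U x 0 k *: Hess x k) (gd eta x) =
      \sum_k 2 * pd k U x * A x (Hess x k) (gd eta x).
    rewrite AformZl Aform_suml mulr_sumr; apply: eq_bigr => k _.
    by rewrite gdE mulrA.
  rewrite mulr_sumr -big_split/=; apply: eq_bigr => k _.
  rewrite gpsi /Aform !(dotDr, dotZr); ring.
rewrite Int_sum => [|k _]; last first.
  by apply: Cc_Aform; [exact: Cont_hess|exact: Cc_gd].
under eq_bigr do rewrite key.
rewrite -Int_sum => [|k _]; last by apply: CcMl => //; exact: C1_pd_continuous.
congr integral_Rn; apply/funext => x; rewrite /dot mulr_suml; apply: eq_bigr => k _.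
by rewrite !gdE mulrA.
Qed.

Variable phi : rV -> R.
Hypotheses (C1phi : C1 phi) (phi0 : forall x, phi x != 0).
Hypotheses (p_ge0 : forall s, 0 <= s -> 0 <= p s)
  (pq_ge0 : forall s, 0 <= s -> 0 <= p s + 2 * s * q s).

(** Of class C^1 also at critical points of U, because it involves the square of |grad U|. *)
Definition test_fun x : R := g x * eta x ^+ 2 / phi x.

Lemma C1_test_fun : C1 test_fun.
Proof.
apply: C1M; last exact: C1V.
by apply: C1M; [exact: C1_sqgrad|exact: C1_sqr].
Qed.

Lemma gd_test_fun x : gd test_fun x =
  (phi x)^-1 *: (eta x ^+ 2 *: (2 *: hess_apply (Hess x) (gd U x)) +
                 (2 * g x * eta x) *: gd eta x)
  - (g x * eta x ^+ 2 / phi x ^+ 2) *: gd phi x.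
Proof.
have C1g := C1_sqgrad C2U.
rewrite /test_fun gd_M; [|by apply: C1M => //; exact: C1_sqr|exact: C1V].
rewrite gd_M ?gd_sqr ?gd_sqgrad//; last exact: C1_sqr.
have -> : gd (fun x => (phi x)^-1) x = - (phi x ^- 2) *: gd phi x.
  by apply/rowP => k; rewrite [in RHS]mxE !gdE pdV//; exact: C1_diff.
apply/rowP => k; rewrite !mxE; field; exact: phi0.
Qed.

Definition rhs_form x : R := g x * A x (gd eta x) (gd eta x).

Definition stab_form x : R := A x (gd phi x) (gd test_fun x).

Lemma Cc_rhs_form : Cc rhs_form.
Proof.
apply: CcMl; first exact: C1_continuous (C1_sqgrad C2U).
by apply: Cc_Aform; [exact: Cont_gd|exact: Cc_gd].
Qed.

Lemma Cc_linear_form : Cc linear_form.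
Proof.
apply: CcD.
  apply: Cc_sum => k _; apply: CcMl; last exact: Cc_sqr.
  by apply: Cont_Aform; exact: Cont_hess.
apply: CcMr => //; apply: Cont_Aform; last exact: Cont_gd.
move=> k; rewrite (_ : (fun x => _) = pd k g).
  exact: C1_pd_continuous (C1_sqgrad C2U).
by apply/funext => x; rewrite -gdE gd_sqgrad.
Qed.

Lemma Cc_test_fun : Cc test_fun.
Proof.
apply: CcMr; last exact: C1_continuous (C1V phi0 C1phi).
by apply: CcMl; [exact: C1_continuous (C1_sqgrad C2U)|exact: Cc_sqr].
Qed.

Lemma Cc_stab_form : Cc stab_form.
Proof.
apply: Cc_Aform; first exact: Cont_gd.
by apply: Cc_gd; [exact: C1_test_fun|exact: Cc_test_fun].
Qed.

Lemma A_ge0 x v : 0 <= A x v v.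
Proof. by apply: Aform_ge0; [exact: p_ge0 (dot_ge0 _)|exact: pq_ge0 (dot_ge0 _)]. Qed.

(** At regular points this is stability_square together with the curvature bound.  At
critical points the gradient of the test function vanishes, because g has a minimum
there, and the right-hand side is sum_k A(grad d_k u, grad d_k u) eta^2, which is
nonnegative. *)
Lemma geometric_le :
  integral_Rn [set x | enorm (gd U x) != 0]
    (fun x => p (g x) * g x * curvature_sq U x * eta x ^+ 2) +
  integral_Rn [set x | enorm (gd U x) != 0]
    (fun x => (2 * q (g x) * g x + p (g x)) *
       enorm (tangential_grad U (fun y => enorm (gd U y)) x) ^+ 2 * eta x ^+ 2) <=
  I rhs_form + I linear_form - I stab_form.
Proof.
have CW := CcB (CcD Cc_rhs_form Cc_linear_form) Cc_stab_form.
rewrite -IntD -?IntB//; [|exact: CcD Cc_rhs_form Cc_linear_form|exact: Cc_stab_form|exact: Cc_rhs_form|exact: Cc_linear_form].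
apply: integral_Rn_superadd => //.
- move=> x /= reg; have [K0 _] := curvature_sq_bounds C2U reg.
  apply: mulr_ge0; last exact: sqr_ge0.
  apply: mulr_ge0; last exact: K0.
  by apply: mulr_ge0; [exact: p_ge0 (dot_ge0 _)|exact: dot_ge0].
- move=> x /= reg.
  apply: mulr_ge0; last exact: sqr_ge0.
  apply: mulr_ge0; last exact: sqr_ge0.
  have := pq_ge0 (dot_ge0 (gd U x)); rewrite -/(g x); lra.
- move=> x /= reg.
  have gh : g x = enorm (gd U x) ^+ 2 by rewrite sqr_enorm.
  have [K0 KT] := curvature_sq_bounds C2U reg.
  rewrite tangential_grad_sqr//.
  have := @stability_square R n (Hess x) (gd U x) (enorm (gd U x)) reg
    (p (g x)) (q (g x)) (eta x) (phi x) (gd eta x) (gd phi x) (phi0 x).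
  rewrite /= -normalE -/(Hess x) -gh.
  rewrite /rhs_form /linear_form /stab_form gd_test_fun => ->.
  set nu := normal U x; set w := hess_apply (Hess x) nu.
  set K := curvature_sq U x; set T := dot w w - dot nu w ^+ 2.
  set F := \sum_k dot _ _ - _ + _.
  set z := Aform _ _ _ _ _.
  have z0 : 0 <= g x * z by apply: mulr_ge0; [exact: dot_ge0|exact: A_ge0].
  have pK : p (g x) * (g x * K) <= p (g x) * F.
    by apply: ler_wpM2l; [exact: p_ge0 (dot_ge0 _)|rewrite gh].
  have := ler_wpM2r (sqr_ge0 (eta x)) pK; lra.
- move=> x /= /negP; rewrite negbK => /eqP h0.
  have g0 : g x = 0 by rewrite /sqgrad -sqr_enorm h0 expr0n.
  have d0 : gd U x = 0 by exact: dot_eq0.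
  have G0 : hess_apply (Hess x) (gd U x) = 0.
    by apply/rowP => k; rewrite !mxE d0 dotC dot0l.
  have Az v : A x v 0 = 0 by rewrite /Aform !(dotC _ 0) !dot0l !mulr0 addr0.
  have t0 : gd test_fun x = 0.
    by rewrite gd_test_fun G0 g0 !(scaler0, mulr0, mul0r, scale0r, addr0, subr0).
  have r0 : rhs_form x = 0 by rewrite /rhs_form g0 mul0r.
  rewrite /stab_form t0 Az subr0 r0 add0r /linear_form G0 scaler0 AformC Az mulr0 addr0.
  apply: sumr_ge0 => k _.
  by apply: mulr_ge0; [exact: A_ge0|exact: sqr_ge0].
Qed.
End OneEquation.

(** * Coupling of the components and conclusion *)

(** Symmetrise the right-hand side and complete the square
(sqrt a_ij t_i - sqrt a_ji t_j)^2. *)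
Lemma coupling_le {R : realType} m (a : 'I_m -> 'I_m -> R) (t : 'I_m -> R) :
  (forall i j, 0 <= a i j) ->
  \sum_i \sum_(j | i != j) Num.sqrt (a i j * a j i) * t i * t j <=
  \sum_i \sum_(j | i != j) a i j * t i ^+ 2.
Proof.
move=> a0; set L := leLHS; set S := leRHS.
have sw : S = \sum_i \sum_(j | i != j) a j i * t j ^+ 2.
  rewrite /S (exchange_big_dep xpredT)//=; apply: eq_bigr => i _.
  by apply: eq_bigl => j; rewrite eq_sym.
suff : L *+ 2 <= S + S by rewrite -mulr2n lerMn2r.
rewrite {2}sw /L /S -sumrMnl -big_split/=; apply: ler_sum => i _.
rewrite -sumrMnl -big_split/=; apply: ler_sum => j _.
rewrite sqrtrM//.
have := sqr_ge0 (Num.sqrt (a i j) * t i - Num.sqrt (a j i) * t j).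
rewrite sqrrB !exprMn !sqr_sqrtr//; lra.
Qed.

(** A derivable function is continuous, so that positivity on ]0, +oo[ passes to 0. *)
Lemma ge0_of_gt0_derivable {R : realType} (p q : R -> R) :
  (forall s : R, is_derive s 1 p (q s)) ->
  (forall s, 0 < s -> 0 < p s) -> forall s, 0 <= s -> 0 <= p s.
Proof.
move=> dp p0 s; rewrite le_eqVlt => /predU1P[<-|/p0/ltW//].
have cp : {for 0, continuous p}.
  by apply: differentiable_continuous; apply/derivable1_diffP; exact: ex_derive.
have cvp : p (step j) @[j --> \oo] --> p 0.
  exact: (cvg_comp _ _ (@cvg_harmonic R) cp).
rewrite -(cvg_lim (@Rhausdorff R) cvp); apply: limr_ge.
  by apply/cvg_ex; exists (p 0).
by apply: nearW => j; apply/ltW/p0; exact: step_gt0.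
Qed.

Lemma gd_chain {R : realType} n m (h : 'rV[R]_m -> R) (u : 'rV[R]_n -> 'rV[R]_m) x v :
  C1 h -> (forall i, C1 (component u i)) ->
  dot (gd (h \o u) x) v = \sum_j pd j h (u x) * dot (gd (component u j) x) v.
Proof.
move=> ch cU.
have [_ Hp] := partial_chain (C1_diff (u x) ch) (fun i => C1_diff x (cU i)).
have -> : gd (h \o u) x = \sum_j pd j h (u x) *: gd (component u j) x.
  apply/rowP => k; rewrite gdE -partial_pd Hp summxE; apply: eq_bigr => j _.
  by rewrite mxE gdE !partial_pd.
by rewrite dot_suml; apply: eq_bigr => j _; rewrite dotZl.
Qed.

Theorem theorem3p1 (R : realType) (m n : nat) (hm : (1 <= m)%N) (hn : (1 <= n)%N)
    (Phi : R -> R)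
    (hPhi : C2_nneg Phi) (hPhi0 : Phi 0 = 0)
    (hPhi_gt0 : forall s, 0 < s -> 0 < Phi s)
    (hPhi1_gt0 : forall s, 0 < s -> 0 < derive_nneg Phi s)
    (hPhi2_gt0 : forall s, 0 < s ->
       0 < derive_nneg Phi s + 2 * s * derive_nneg (derive_nneg Phi) s)
    (H : 'I_m -> 'rV[R]_m -> R)
    (hH : forall i, C1 (H i))
    (hHsym : forall (i j : 'I_m) (v : 'rV[R]_m), (i <= j)%N ->
       0 < partial i (H j) v * partial j (H i) v)
    (u : 'rV[R]_n -> 'rV[R]_m)
    (hu : classical_solution Phi H u)
    (hstable : stable Phi H u)
    (eta : 'I_m -> 'rV[R]_n -> R)
    (heta : forall i, C1c (eta i)) :
  let Phi' := derive_nneg Phi in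
  let Phi'' := derive_nneg (derive_nneg Phi) in
  let U := component u in
  let normDU (i : 'I_m) x := enorm (grad (U i) x) in
  \sum_i \sum_(j | i != j)
    integral_Rn setT (fun x =>
      Num.sqrt (partial j (H i) (u x) * partial i (H j) (u x))
        * normDU i x * normDU j x * eta i x * eta j x
      - partial j (H i) (u x) * dot (grad (U i) x) (grad (U j) x)
        * eta i x ^+ 2)
  + \sum_i
    integral_Rn [set x | normDU i x != 0] (fun x =>
      Phi' (normDU i x ^+ 2) * normDU i x ^+ 2 * curvature_sq (U i) x
        * eta i x ^+ 2)
  + \sum_i
    integral_Rn [set x | normDU i x != 0] (fun x =>
      (2 * Phi'' (normDU i x ^+ 2) * normDU i x ^+ 2 + Phi' (normDU i x ^+ 2))
        * enorm (tangential_grad (U i) (normDU i) x) ^+ 2 * eta i x ^+ 2)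
  <= \sum_i
    integral_Rn setT (fun x =>
      2 * normDU i x ^+ 2 * Phi'' (normDU i x ^+ 2)
        * `|dot (grad (U i) x) (grad (eta i) x)| ^+ 2
      + Phi' (normDU i x ^+ 2) * normDU i x ^+ 2
        * enorm (grad (eta i) x) ^+ 2).
Proof.
(* The inequality coerces a boolean that starts with the local definitions, which
   therefore have to be reduced before they can be named. *)
cbv zeta; set Phi' := derive_nneg Phi; set Phi'' := derive_nneg Phi'.
set U := component u; set normDU := fun (i : 'I_m) x => enorm (grad (U i) x).
(* p and q are Phi' and Phi'', extended to the whole line so as to use the chain
   rule at critical points. *)
have [p [q [pE qE dp cq]]] := C2_nneg_extend hPhi.
have p_ge0 : forall s, 0 <= s -> 0 <= p s.
  by apply: (ge0_of_gt0_derivable dp) => s s0; rewrite pE ?ltW//; exact: hPhi1_gt0.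
have pq_ge0 s : 0 <= s -> 0 <= p s + 2 * s * q s.
  rewrite le_eqVlt => /predU1P[<-|s0]; first by rewrite mulr0 mul0r addr0 p_ge0.
  by rewrite pE ?qE ?ltW//; exact: hPhi2_gt0.
have [C2U eqU] := hu; have [phi [C1phi _ phi_pos phi_weak]] := hstable.
have C1U i : C1 (U i) := C2_C1 (C2U i).
have C1eta i : C1 (eta i) by case: (heta i).
have Cceta i : Cc (eta i) := C1c_Cc (heta i).
have phi0 i x : phi i x != 0.
  by apply: contraTneq (phi_pos i i x) => ->; rewrite mulr0 ltxx.
pose P i := stab_form p q (U i) (eta i) (phi i).
pose L i := linear_form p q (U i) (eta i).
pose E i := rhs_form p q (U i) (eta i).
have geo i := geometric_le dp cq (C2U i) (C1eta i) (Cceta i) (C1phi i) (phi0 i) p_ge0 pq_ge0.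
have normE i x : normDU i x = enorm (gd (U i) x) by rewrite /normDU grad_gd.
have Phi1E i x : Phi' (enorm (gd (U i) x) ^+ 2) = p (sqgrad (U i) x).
  by rewrite sqr_enorm pE// dot_ge0.
have Phi2E i x : Phi'' (enorm (gd (U i) x) ^+ 2) = q (sqgrad (U i) x).
  by rewrite sqr_enorm qE// dot_ge0.
have fE i : normDU i = (fun x => enorm (gd (U i) x)) by apply/funext => x; exact: normE.
clearbody normDU Phi'' Phi'.
pose X i := integral_Rn [set x | enorm (gd (U i) x) != 0]
    (fun x => p (sqgrad (U i) x) * sqgrad (U i) x * curvature_sq (U i) x * eta i x ^+ 2).
pose Y i := integral_Rn [set x | enorm (gd (U i) x) != 0]
    (fun x => (2 * q (sqgrad (U i) x) * sqgrad (U i) x + p (sqgrad (U i) x)) *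
       enorm (tangential_grad (U i) (fun y => enorm (gd (U i) y)) x) ^+ 2 * eta i x ^+ 2).
have EX i : integral_Rn [set x | normDU i x != 0] (fun x =>
    Phi' (normDU i x ^+ 2) * normDU i x ^+ 2 * curvature_sq (U i) x * eta i x ^+ 2) = X i.
  rewrite fE; congr integral_Rn; apply/funext => x.
  by rewrite Phi1E sqr_enorm.
have EY i : integral_Rn [set x | normDU i x != 0] (fun x =>
    (2 * Phi'' (normDU i x ^+ 2) * normDU i x ^+ 2 + Phi' (normDU i x ^+ 2))
    * enorm (tangential_grad (U i) (normDU i) x) ^+ 2 * eta i x ^+ 2) = Y i.
  rewrite fE; congr integral_Rn; apply/funext => x.
  by rewrite Phi1E Phi2E sqr_enorm.
have EE i : integral_Rn setT (fun x =>
    2 * normDU i x ^+ 2 * Phi'' (normDU i x ^+ 2) * `|dot (grad (U i) x) (grad (eta i) x)| ^+ 2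
    + Phi' (normDU i x ^+ 2) * normDU i x ^+ 2 * enorm (grad (eta i) x) ^+ 2) =
    integral_Rn setT (E i).
  rewrite fE; congr integral_Rn; apply/funext => x.
  rewrite Phi1E Phi2E !sqr_enorm real_normK ?num_real// !grad_gd /E /rhs_form /Aform /sqgrad.
  by ring.
pose tau i := test_fun (U i) (eta i) (phi i).
have C1tau i : C1 (tau i) by apply: C1_test_fun.
have Cctau i : Cc (tau i) by apply: Cc_test_fun.
have C1ctau i : C1c (tau i).
  apply: (C1c_sub (heta i) (C1tau i)) => x etax.
  by rewrite /tau /test_fun etax expr0n mulr0 mul0r.
pose a i j x := pd j (H i) (u x).
have ca i j : continuous (a i j).
  move=> x; apply: continuous_comp; last exact: C1_pd_continuous.
  apply: differentiable_continuous; apply: differentiable_components => k.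
  exact: C1_diff (C1U k).
pose M i x := (\sum_j a i j x * phi j x) * tau i x.
pose N i x := (\sum_j a i j x * dot (gd (U j) x) (gd (U i) x)) * eta i x ^+ 2.
have CM i : Cc (M i).
  apply: CcMl => //; apply: Cont_sum => j _; apply: ContM => //.
  exact: C1_continuous.
have CN i : Cc (N i).
  apply: CcMl; last exact: Cc_sqr.
  apply: Cont_sum => j _; apply: ContM => //; apply: Cont_dot; exact: Cont_gd.
have PM i : integral_Rn setT (P i) = integral_Rn setT (M i).
  have := phi_weak i _ (C1ctau i); rewrite /M /a -partial_pd => <-.
  congr integral_Rn; apply/funext => x; rewrite Aform_Amx !grad_gd.
  by rewrite -[dot _ _]/(sqgrad (U i) x) -pE -?qE ?dot_ge0.
have LN i : integral_Rn setT (L i) = integral_Rn setT (N i).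
  rewrite /L (linearized_tested dp cq (C2U i) (C1eta i) (Cceta i) (h := H i \o u)).
  - congr integral_Rn; apply/funext => x; rewrite gd_chain//.
  - exact: C1_chain.
  - move=> x; rewrite -[RHS]eqU /div partial_pd; congr (- _).
    apply: eq_bigr => l _; congr (pd l _ x); apply/funext => y.
    by rewrite mxE grad_gd gdE sqr_enorm pE// dot_ge0.
pose Q i j x := Num.sqrt (partial j (H i) (u x) * partial i (H j) (u x))
        * normDU i x * normDU j x * eta i x * eta j x
      - partial j (H i) (u x) * dot (grad (U i) x) (grad (U j) x) * eta i x ^+ 2.
have CQ i j : Cc (Q i j).
  rewrite /Q fE (fE j) grad_gd !partial_pd.
  have ch k : continuous (fun x => enorm (gd (U k) x)).
    move=> x; apply: (@continuous_comp _ _ _ (sqgrad (U k)) Num.sqrt).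
      by apply: C1_continuous; exact: C1_sqgrad.
    exact: sqrt_continuous.
  apply: CcB; last first.
    apply: CcMl; last exact: Cc_sqr.
    by apply: ContM; [exact: ca|apply: Cont_dot; exact: Cont_gd].
  apply: CcMl => //; apply: ContM; last exact: C1_continuous.
  apply: ContM => //; apply: ContM => //.
  move=> x; apply: (@continuous_comp _ _ _ (fun x => a i j x * a j i x) Num.sqrt).
    exact: ContM.
  exact: sqrt_continuous.
(* The diagonal terms of M and N cancel since b i i * t i ^+ 2 = a i i * g_i * eta_i^2. *)
have QMN x : \sum_i \sum_(j | i != j) Q i j x <= \sum_i (M i x - N i x).
  pose t i := enorm (gd (U i) x) * eta i x.
  pose b i j := a i j x * phi j x / phi i x.
  have b_ge0 i j : 0 <= b i j.
    have := phi_pos i j x; rewrite partial_pd -/(a i j x) => pos.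
    rewrite (_ : b i j = a i j x * phi j x * phi i x / phi i x ^+ 2).
      by rewrite divr_ge0 ?sqr_ge0// ltW.
    by rewrite /b; field.
  pose c i j := a i j x * dot (gd (U i) x) (gd (U j) x) * eta i x ^+ 2.
  have QE i j : Q i j x = Num.sqrt (b i j * b j i) * t i * t j - c i j.
    rewrite /Q !normE grad_gd !partial_pd -/(a i j x) -/(a j i x) -/(c i j).
    rewrite (_ : b i j * b j i = a i j x * a j i x); first by rewrite /t; ring.
    by rewrite /b; field; rewrite !phi0.
  have t2 i : t i ^+ 2 = sqgrad (U i) x * eta i x ^+ 2 by rewrite exprMn sqr_enorm.
  have MNE i : M i x - N i x = \sum_(j | i != j) (b i j * t i ^+ 2 - c i j).
    rewrite /M /N !mulr_suml -sumrB (bigD1 i)//= (_ : _ - _ = 0) ?add0r.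
      under eq_bigl do rewrite eq_sym.
      apply: eq_bigr => j _; rewrite t2 /b /c /tau /test_fun (dotC (gd (U j) x)).
      by field.
    by rewrite /tau /test_fun /sqgrad; field.
  under eq_bigr do under eq_bigr do rewrite QE.
  under [leRHS]eq_bigr do rewrite MNE sumrB.
  under eq_bigr do rewrite sumrB.
  by rewrite !sumrB lerD2r; exact: coupling_le.
have QPL : \sum_i \sum_(j | i != j) integral_Rn setT (Q i j) <=
    \sum_i (integral_Rn setT (P i) - integral_Rn setT (L i)).
  under [leRHS]eq_bigr do rewrite PM LN -IntB//.
  rewrite -Int_sum => [|i _]; last exact: CcB.
  under eq_bigr do rewrite -Int_sum//.
  rewrite -Int_sum => [|i _]; last exact: Cc_sum.
  apply: Int_le => //.
    by apply: Cc_sum => i _; exact: Cc_sum.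
  by apply: Cc_sum => i _; exact: CcB.
have G : \sum_i X i + \sum_i Y i <= \sum_i integral_Rn setT (E i)
    + \sum_i integral_Rn setT (L i) - \sum_i integral_Rn setT (P i).
  by rewrite -!big_split/= -sumrB; apply: ler_sum => i _; exact: geo.
rewrite (eq_bigr _ (fun i _ => EX i)) (eq_bigr _ (fun i _ => EY i)).
rewrite (eq_bigr _ (fun i _ => EE i)) -addrA.
apply: le_trans (lerD QPL G) _; rewrite sumrB.
move: (\sum_i integral_Rn setT (P i)) (\sum_i integral_Rn setT (L i)) => A B.
by move: (\sum_i integral_Rn setT (E i)) => C; lra.
Qed.
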